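(* Let $\lambda>0$ and let $P_3(\theta_1,\theta_2,\theta_3)=1+p_1\theta_1+p_2\theta_2+p_3\theta_3+p_{1,2}\theta_1\theta_2+p_{1,3}\theta_1\theta_3+p_{2,3}\theta_2\theta_3+p_{1,2,3}\theta_1\theta_2\theta_3$ with $p_1,p_2,p_3,p_{1,2},p_{1,3},p_{2,3},p_{1,2,3}>0$ and $$\widetilde b_{1,2}=\frac{p_{1,3}p_{2,3}}{p_{1,2,3}^2}-\frac{p_3}{p_{1,2,3}}>0,\quad \widetilde b_{1,3}=\frac{p_{1,2}p_{2,3}}{p_{1,2,3}^2}-\frac{p_2}{p_{1,2,3}}>0,\quad \widetilde b_{2,3}=\frac{p_{1,3}p_{1,2}}{p_{1,2,3}^2}-\frac{p_1}{p_{1,2,3}}>0,$$ $$\widetilde b_{1,2,3}=-\frac1{p_{1,2,3}}+\frac{p_{2,3}p_1}{p_{1,2,3}^2}+\frac{p_{1,3}p_2}{p_{1,2,3}^2}+\frac{p_{1,2}p_3}{p_{1,2,3}^2}-\frac{2p_{2,3}p_{1,3}p_{1,2}}{p_{1,2,3}^3}>0.$$ Put $-\widetilde p_2=p_{1,3}/p_{1,2,3}$, $-\widetilde p_3=p_{1,2}/p_{1,2,3}$, $-\widetilde p_{2,3}=p_1/p_{1,2,3}$, $S_{2,3}(\theta_2,\theta_3)=1+\tfrac{p_{1,2}}{p_1}\theta_2+\tfrac{p_{1,3}}{p_1}\theta_3+\tfrac{p_{1,2,3}}{p_1}\theta_2\theta_3$, and $$\alpha_1=\tfrac{\widetilde b_{1,2}}{(-\widetilde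 p_2)},\ \alpha_2=\tfrac{\widetilde b_{1,3}}{(-\widetilde p_3)},\ \alpha_3=\tfrac{\widetilde b_{1,2,3}}{(-\widetilde p_{2,3})},\ \alpha_4=\tfrac{\widetilde b_{1,2}\widetilde b_{2,3}}{(-\widetilde p_2)(-\widetilde p_{2,3})},\ \alpha_5=\tfrac{\widetilde b_{1,3}\widetilde b_{2,3}}{(-\widetilde p_3)(-\widetilde p_{2,3})},\ \alpha_6=\tfrac{\widetilde b_{2,3}}{(-\widetilde p_3)}.$$ Let $X_1\sim\gamma_{(p_1,\lambda)}$ and, given $X_1$, let $V_1,\dots,V_5$ be independent with $V_i\sim\mathcal P(\alpha_iX_1)$. Given these variables, let $Z_2'\sim\gamma_{(p_{1,2}/p_1,\ \lambda+V_3+V_4+V_5)}$, $Y_2\sim\gamma_{((-\widetilde p_2)^{-1},\,V_1+V_4)}$ and $Y_3\sim\gamma_{((-\widetilde p_3)^{-1},\,V_2+V_5)}$; given moreover $Z_2'$, let $V_6\sim\mathcal P(\alpha_6Z_2')$; and, given moreover $V_6$, let $Z_3'\sim\gamma_{((-\widetilde p_3)^{-1},\,\lambda+V_3+V_4+V_5+V_6)}$; here, given $X_1,V_1,\dots,V_5$, the variables $Y_2$, $Y_3$ and the triple $(Z_2',V_6,Z_3')$ are independent. Then, given $X_1,V_1,\dots,V_5$, $(Z_2',Z_3')\sim\boldsymbol\gamma_{(S_{2,3},\,\lambda+V_3+V_4+V_5)}$; and, setting $(X_2,X_3)=(Y_2+Z_2',Y_3+Z_3')$, one has $(X_1,X_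2,X_3)\sim\boldsymbol\gamma_{(P_3,\lambda)}$.
   Context: For a polynomial $P$ of degree at most one in each variable with $P(\mathbf 0)=1$ and $\lambda>0$, the multivariate gamma distribution $\boldsymbol\gamma_{(P,\lambda)}$ is the probability distribution of a random vector $\mathbf X$ with $\mathbb E[\exp(-\sum_i\theta_iX_i)]=[P(\boldsymbol\theta)]^{-\lambda}$ for $\boldsymbol\theta$ in a set with non-empty interior. In dimension one, for $a>0$, $\gamma_{(a,\lambda)}$ is the gamma distribution with Laplace transform $(1+a\theta)^{-\lambda}$; with shape parameter $0$ it is the point mass at $0$. $\mathcal P(\mu)$ is the Poisson distribution with parameter $\mu$. *)

(* Defs.v *)
From HB Require Import structures.
From mathcomp Require Import all_boot all_order all_algebra.
From mathcomp Require Import all_classical all_reals all_analysis.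

Set Implicit Arguments.
Unset Strict Implicit.
Unset Printing Implicit Defensive.

Import Order.TTheory GRing.Theory Num.Theory.
Import numFieldNormedType.Exports.

Local Open Scope classical_set_scope.
Local Open Scope ring_scope.

Definition multi_affine (R : realType) (n : nat) (Q : 'rV[R]_n -> R) : Prop :=
  exists c : {set 'I_n} -> R,
    forall theta, Q theta = \sum_(A : {set 'I_n}) c A * \prod_(i in A) theta 0 i.

(** [mgamma Q lambda mu]: the law [mu] on R^n is gamma_(Q, lambda).  The
    positivity of [Q theta] on the domain makes the real power [Q theta `^ _]
    meaningful ([powR] is a junk value on negative reals). *)
Definition mgamma (R : realType) (n : nat) (Q : 'rV[R]_n -> R) (lambda : R)
    (mu : set (n.-tuple R) -> \bar R) : Prop :=
  [/\ multi_affine Q, Q 0 = 1, 0 < lambda &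
    exists D : set 'rV[R]_n, interior D !=set0 /\
      forall theta, D theta -> 0 < Q theta /\
        (\int[mu]_x (expR (- \sum_(i < n) theta 0 i * tnth x i))%:E
          = (Q theta `^ (- lambda))%:E)%E].

Definition gamma_fun (R : realType) (s : R) : R :=
  \int[lebesgue_measure]_(x in `]0, +oo[) (x `^ (s - 1) * expR (- x)).

(** Scale [a], shape [s]: the Laplace transform is (1 + a theta)^(-s). *)
Definition gamma_pdf (R : realType) (a s x : R) : R :=
  if 0 < x then x `^ (s - 1) * expR (- (x / a)) / (gamma_fun s * a `^ s) else 0.

Definition gamma_prob (R : realType) (a s : R) (U : set R) : \bar R :=
  if 0 < s then (\int[lebesgue_measure]_(x in U) (gamma_pdf a s x)%:E)%E
  else \d_(0 : R) U.

(** The last argument of [poisson_prob] is unused; for [mu = 0] it is the point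
    mass at 0. *)
Definition poisson (R : realType) (mu : R) : set nat -> \bar R :=
  poisson_prob mu 0.

Section conditioning.
Context {R : realType} {d : measure_display} {T : measurableType d}.
Context (P : probability T R).
Context {dX : measure_display} {TX : measurableType dX} (X : T -> TX).

Definition regular_cond_dist {dY} {TY : measurableType dY} (Y : T -> TY)
    (k : R.-pker TX ~> TY) : Prop :=
  forall (A : set TX) (B : set TY), measurable A -> measurable B ->
    (P (X @^-1` A `&` Y @^-1` B) = \int[P]_(w in X @^-1` A) k (X w) B)%E.

(** Given [X], the law of [Y] satisfies [L X] almost surely; regular conditional
    distributions being almost surely unique on standard Borel spaces, the choice
    of the version [k] is then irrelevant. *)
Definition cond_law {dY} {TY : measurableType dY} (Y : T -> TY)
    (L : TX -> (set TY -> \bar R) -> Prop) : Prop :=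
  exists k : R.-pker TX ~> TY, regular_cond_dist Y k /\
    {ae P, forall w, L (X w) (k (X w))}.

Definition same_law {dY} {TY : measurableType dY} (nu mu : set TY -> \bar R) :
    Prop :=
  forall B, measurable B -> mu B = nu B.

(** [g \o X] is a version of the conditional probability of [E] given [X]. *)
Definition cond_prob (E : set T) (g : TX -> R) : Prop :=
  measurable_fun [set: TX] g /\
  forall A : set TX, measurable A ->
    (P (X @^-1` A `&` E) = \int[P]_(w in X @^-1` A) (g (X w))%:E)%E.

(** Mutual conditional independence, given [X], of a finite family of
    sigma-algebras (each contains the whole space, so that subfamilies are
    covered).  Versions [g i] always exist and are almost surely unique, by
    Radon-Nikodym. *)
Definition cond_indep {n} (F : n.-tuple (set_system T)) : Prop :=
  forall E : 'I_n -> set T, (forall i, tnth F i (E i)) ->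
  forall g : 'I_n -> TX -> R, (forall i, cond_prob (E i) (g i)) ->
    cond_prob (\bigcap_i E i) (fun x => \prod_(i < n) g i x).

End conditioning.

Definition sigma_of {d} {T : measurableType d} {dY} {TY : measurableType dY}
    (Y : T -> TY) : set_system T :=
  preimage_set_system [set: T] Y measurable.

(* Main.v *)
Require Import Defs.
From HB Require Import structures.
From mathcomp Require Import all_boot all_order all_algebra.
From mathcomp Require Import all_classical all_reals all_analysis.
From mathcomp Require Import measurable_realfun ring.

(** The Laplace transform is computed on the open positive orthant by successive
    conditioning.  Given [X1] and the [Vi], mixing the gamma law of [Z3'] over
    the Poisson variable [V6] and then over [Z2'] gives the transform
    [S^-(lambda+n)] of the pair [(Z2', Z3')], where [n = V3 + V4 + V5] and
    [S] is [S23] at [(theta2, theta3)].  Multiplying by the gamma transforms of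
    [Y2] and [Y3] turns the conditional transform into
    [S^-lambda * \prod_i rho_i ^ Vi] with
    [rho = (r2, r3, 1/S, r2/S, r3/S)], [r2 = 1/(1 + theta2/(-p~2))] and
    [r3 = 1/(1 + theta3/(-p~3))].  The Poisson generating functions make it
    [S^-lambda * exp(- sum_i alpha_i (1 - rho_i) X1)], and the gamma transform
    of [X1] leaves the rational identity
    [S * (1 + p1 (theta1 + sum_i alpha_i (1 - rho_i))) = P3].

    The conditional law of [(Z2', Z3')] depends on the conditioning variables
    through [n] only, so the law of the pair conditioned on the events [n = k]
    provides the regular conditional distribution, without any disintegration
    theorem. *)

Set Implicit Arguments.
Unset Strict Implicit.
Unset Printing Implicit Defensive.

Import Order.TTheory GRing.Theory Num.Theory.
Import numFieldNormedType.Exports.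

Local Open Scope classical_set_scope.
Local Open Scope ring_scope.

Lemma preimage_measurable {d d'} {T : measurableType d} {U : measurableType d'}
    (f : T -> U) (B : set U) :
  measurable_fun setT f -> measurable B -> measurable (f @^-1` B).
Proof. by move=> mf mB; rewrite -[_ @^-1` _]setTI; exact: mf. Qed.

(** * Functionals that behave like integrals of nonnegative functions *)

Section integral_like.
Local Open Scope ereal_scope.
Context {d : measure_display} {T : measurableType d} {R : realType}.
Implicit Types (f g : T -> \bar R) (Phi Psi : (T -> \bar R) -> \bar R).

Definition mge0 f := measurable_fun [set: T] f /\ forall x, 0 <= f x.

(** Two functionals of this kind that agree on indicators agree on all
    nonnegative measurable functions, which replaces the standard machine. *)
Definition integral_like Phi :=
  [/\ forall (k : R) f, (0 <= k)%R -> mge0 f ->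
        Phi (fun x => k%:E * f x) = k%:E * Phi f,
      forall f g, mge0 f -> mge0 g -> Phi (fun x => f x + g x) = Phi f + Phi g &
      forall f_ : (T -> \bar R)^nat, (forall n, mge0 (f_ n)) ->
        (forall x, nondecreasing_seq (f_ ^~ x)) ->
        Phi (fun x => limn (f_ ^~ x)) = limn (fun n => Phi (f_ n))].

Lemma mge0_indic (A : set T) : measurable A -> mge0 (fun x => (\1_A x)%:E).
Proof.
move=> mA; split => [|x]; last by rewrite lee_fin.
by apply/measurable_EFinP; exact: measurable_indic.
Qed.

Lemma mge0D f g : mge0 f -> mge0 g -> mge0 (fun x => f x + g x).
Proof.
by move=> [mf f0] [mg g0]; split => [|x]; [exact: emeasurable_funD|exact: adde_ge0].
Qed.

Lemma mge0M f g : mge0 f -> mge0 g -> mge0 (fun x => f x * g x).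
Proof.
by move=> [mf f0] [mg g0]; split => [|x]; [exact: emeasurable_funM|exact: mule_ge0].
Qed.

Lemma mge0_cst (k : \bar R) : 0 <= k -> mge0 (fun=> k).
Proof. by move=> k0; split => //; exact: measurable_cst. Qed.

Lemma mge0_EFin (f : T -> R) : measurable_fun setT f -> (forall x, 0 <= f x)%R ->
  mge0 (fun x => (f x)%:E).
Proof. by move=> mf f0; split => [|x]; [exact/measurable_EFinP|rewrite lee_fin]. Qed.

Lemma integral_like0 Phi : integral_like Phi -> Phi (fun=> 0) = 0.
Proof.
move=> [PhiZ _ _]; have := PhiZ 0%R (fun=> 0) (lexx _) (mge0_cst (lexx 0)).
by rewrite !mul0e.
Qed.

Lemma integral_like_sum Phi (I : Type) (s : seq I) (F : I -> T -> \bar R) :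
  integral_like Phi -> (forall i, mge0 (F i)) ->
  mge0 (fun x => \sum_(i <- s) F i x) /\
  Phi (fun x => \sum_(i <- s) F i x) = \sum_(i <- s) Phi (F i).
Proof.
move=> HPhi mF; elim: s => [|i s [ms IH]].
  rewrite big_nil; under eq_fun do rewrite big_nil.
  by split; [exact: mge0_cst|exact: integral_like0].
rewrite big_cons; under eq_fun do rewrite big_cons.
by split; [exact: mge0D|case: HPhi => _ HD _; rewrite HD// IH].
Qed.

Import HBNNSimple.

(** A simple function is a finite sum of nonnegative multiples of indicators, and a nonnegative
    measurable function is an increasing limit of simple ones. *)
Lemma eq_integral_like Phi Psi f : integral_like Phi -> integral_like Psi ->
  (forall A, measurable A ->
    Phi (fun x => (\1_A x)%:E) = Psi (fun x => (\1_A x)%:E)) ->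
  mge0 f -> Phi f = Psi f.
Proof.
move=> HPhi HPsi PhiPsi [mf f0].
have nnE (h : {nnsfun T >-> R}) : Phi (EFin \o h) = Psi (EFin \o h).
  pose s := finmap.enum_fset (fset_set (range h)).
  (* The values of [h] are nonnegative, so [Num.max 0 r] is [r] on them; it makes the summand
     nonnegative for every [r], as [integral_like_sum] asks. *)
  have hE : EFin \o h =
      fun x => \sum_(r <- s) ((Num.max 0 r)%:E * (\1_(h @^-1` [set r]) x)%:E).
    apply/funext => x /=; rewrite fimfunE fsbig_finite//= -sumEFin.
    rewrite big_seq [RHS]big_seq; apply: eq_bigr => r.
    rewrite in_fset_set// inE => -[y _ <-].
    by rewrite EFinM max_r.
  have mI r : mge0 (fun x => (Num.max 0 r)%:E * (\1_(h @^-1` [set r]) x)%:E).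
    apply: mge0M; last exact: mge0_indic.
    by apply: mge0_cst; rewrite lee_fin le_max lexx.
  rewrite hE (integral_like_sum s HPhi mI).2 (integral_like_sum s HPsi mI).2.
  apply: eq_bigr => r _.
  case: HPhi HPsi => HPhi _ _ [HPsi _ _].
  by rewrite HPhi ?HPsi ?PhiPsi ?le_max ?lexx//; exact: mge0_indic.
pose h := nnsfun_approx measurableT mf.
have fE : f = fun x => limn (fun n => (EFin \o h n) x).
  apply/funext => x; apply/esym/cvg_lim => //.
  exact: (@cvg_nnsfun_approx _ _ _ _ measurableT _ mf (fun x _ => f0 x)).
have mh n : mge0 (EFin \o h n).
  by split => [|x]; [exact/measurable_EFinP|rewrite lee_fin].
have ndh x : nondecreasing_seq (fun n => (EFin \o h n) x).
  by move=> a b ab; rewrite lee_fin; exact/lefP/nd_nnsfun_approx.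
rewrite fE; case: HPhi HPsi => _ _ HPhi [_ _ HPsi].
by rewrite HPhi ?HPsi//; under eq_fun do rewrite nnE.
Qed.

(** Agreement on a pi-system that contains the whole space spreads to the generated sigma-algebra by
    Dynkin's theorem. The finiteness of [Phi] at 1 permits the subtraction in the complement
    step. *)
Lemma eq_integral_like_setI Phi Psi (G : set (set T)) f :
  integral_like Phi -> integral_like Psi ->
  @measurable _ T = <<s G >> -> setI_closed G -> G setT ->
  (forall A, G A -> Phi (fun x => (\1_A x)%:E) = Psi (fun x => (\1_A x)%:E)) ->
  (Phi (fun=> 1) < +oo) ->
  (forall A, measurable A -> 0 <= Phi (fun x => (\1_A x)%:E)) ->
  mge0 f -> Phi f = Psi f.
Proof.
move=> HPhi HPsi mE GI GT PhiPsi Phioo Phi0 mf.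
apply: eq_integral_like => // A; rewrite mE.
have ET : Phi (fun=> 1) = Psi (fun=> 1).
  by have := PhiPsi _ GT; under eq_fun do rewrite indicT.
have ind1 : (fun x => (\1_[set: T] x)%:E) = (fun=> 1 : \bar R).
  by apply/funext => x; rewrite indicT.
apply: (@dynkin_induction _ _ G (fun A =>
  Phi (fun x => (\1_A x)%:E) = Psi (fun x => (\1_A x)%:E))) => //.
- by rewrite ind1.
- move=> S mS; have mC := mge0_indic (measurableC mS).
  have mI := mge0_indic mS => ES.
  have : Phi (fun=> 1) = Psi (fun=> 1) by [].
  have -> : (fun=> 1) = (fun x => (\1_S x)%:E + (\1_(~` S) x)%:E) :> (T -> \bar R).
    by apply/funext => x; rewrite -EFinD !indicE in_setC; case: (x \in S);
      rewrite ?addr0 ?add0r.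
  have Phi1 : Phi (fun x => (\1_S x)%:E) + Phi (fun x => (\1_(~` S) x)%:E) < +oo.
    case: (HPhi) => _ <- // _; move: Phioo; congr (Phi _ < _).
    by apply/funext => x; rewrite -EFinD !indicE in_setC; case: (x \in S);
      rewrite ?addr0 ?add0r.
  case: (HPhi) => _ -> // _; case: (HPsi) => _ -> // _; rewrite -ES => ESC.
  have Sfin : Phi (fun x => (\1_S x)%:E) \is a fin_num.
    rewrite ge0_fin_numE ?Phi0//; apply: le_lt_trans Phi1.
    by rewrite leeDl// Phi0//; exact: measurableC.
  by rewrite -[LHS](addeK _ Sfin) [X in X - _]addeC ESC [X in X - _]addeC addeK.
- move=> F mF tF EF.
  (* The indicator of a disjoint union is the increasing limit of these partial sums. *)
  pose S n x := \sum_(0 <= i < n) (\1_(F i) x)%:E : \bar R.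
  have -> : (fun x => (\1_(\bigcup_k F k) x)%:E) = (fun x => limn (S ^~ x)) :> (T -> \bar R).
    by apply/funext => x; rewrite indic_bigcup.
  have mI i : mge0 (fun x => (\1_(F i) x)%:E) by exact: mge0_indic.
  have mS n : mge0 (S n) by have [] := integral_like_sum (index_iota 0 n) HPhi mI.
  have ndS x : nondecreasing_seq (S ^~ x).
    by move=> a b ab; apply: lee_sum_nneg_natr => // i _ _; rewrite lee_fin.
  case: (HPhi) => _ _ -> //; case: (HPsi) => _ _ -> //.
  congr (limn _); apply/funext => n.
  rewrite (integral_like_sum _ HPhi mI).2 (integral_like_sum _ HPsi mI).2.
  by apply: eq_bigr => i _; exact: EF.
Qed.

End integral_like.

Section integral_like_instances.
Local Open Scope ereal_scope.
Context {d dX dY : measure_display} {T : measurableType d} {TX : measurableType dX}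
  {TY : measurableType dY} {R : realType}.
Variables (m : {measure set T -> \bar R}) (D : set T) (mD : measurable D).
Variables (U : T -> R) (mU : mge0 (EFin \o U)).

Lemma limn_mulr (u : (\bar R)^nat) (r : R) : nondecreasing_seq u ->
  limn u * r%:E = limn (fun n => u n * r%:E).
Proof.
move=> ndu; apply/esym/cvg_lim => //; apply: cvgeZr => //.
exact: ereal_nondecreasing_is_cvgn.
Qed.

(** The domain [D] and the weight [U] allow for integrals over events of [X] and for products whose
    other factors are held fixed. *)
Lemma integral_like_weight d' (T' : measurableType d') (Y : T -> T') :
  measurable_fun setT Y ->
  integral_like (fun f : T' -> \bar R => \int[m]_(w in D) (f (Y w) * (U w)%:E)).
Proof.
move=> mY; have mf (f : T' -> \bar R) : mge0 f -> measurable_fun D (fun w => f (Y w)).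
  by move=> [mf _]; apply: measurable_funTS; exact: measurableT_comp.
have mUD : measurable_fun D (EFin \o U) by apply: measurable_funTS; case: mU.
have U0 w : 0 <= (U w)%:E by exact: (mU.2 w).
split; [move=> c f c0 hf|move=> f g hf hg|move=> f_ hf ndf].
- under eq_integral do rewrite -muleA.
  rewrite ge0_integralZl//.
  + by apply: emeasurable_funM => //; exact: mf.
  + by move=> w _; apply: mule_ge0 => //; case: hf.
- under eq_integral.
    by move=> w _; rewrite ge0_muleDl; [over|case: hf|case: hg].
  rewrite ge0_integralD//.
  + by move=> w _; apply: mule_ge0 => //; case: hf.
  + by apply: emeasurable_funM => //; exact: mf.
  + by move=> w _; apply: mule_ge0 => //; case: hg.
  + by apply: emeasurable_funM => //; exact: mf.
- under eq_integral do rewrite limn_mulr//.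
  rewrite monotone_convergence//.
  + by move=> n; apply: emeasurable_funM => //; exact: mf.
  + by move=> n w _; apply: mule_ge0 => //; case: (hf n).
  + by move=> w _ a b ab; apply: lee_wpmul2r => //; exact: ndf.
Qed.

Lemma integral_like_integral d' (T' : measurableType d')
    (mu : {measure set T' -> \bar R}) :
  integral_like (fun f => \int[mu]_x f x).
Proof.
split; [move=> c f c0 [mf f0]|move=> f g [mf f0] [mg g0]|move=> f_ hf ndf].
- by rewrite ge0_integralZl//= lee_fin.
- by rewrite ge0_integralD.
- rewrite monotone_convergence// => [n|n x _]; first by case: (hf n).
  exact: (hf n).2.
Qed.

Lemma integral_kernel_mge0 (k : R.-pker TX ~> TY) (f : TX * TY -> \bar R) :
  mge0 f -> mge0 (fun x => \int[k x]_y f (x, y)).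
Proof.
move=> [mf f0]; split; first exact: measurable_fun_integral_finite_kernel.
by move=> x; exact: integral_ge0.
Qed.

(** Integrating out the second variable first reduces this to [integral_like_weight] for functions
    of the first one. *)
Lemma integral_like_kernel (X : T -> TX) (k : R.-pker TX ~> TY) :
  measurable_fun setT X ->
  integral_like (fun f : TX * TY -> \bar R =>
    \int[m]_(w in D) ((\int[k (X w)]_y f (X w, y)) * (U w)%:E)).
Proof.
move=> mX; have [HZ HD HL] := integral_like_weight mX.
have ms (f : TX * TY -> \bar R) x : mge0 f -> mge0 (fun y => f (x, y)).
  by move=> [mf f0]; split => //; exact: measurableT_comp.
split; [move=> c f c0 hf|move=> f g hf hg|move=> f_ hf ndf].
- rewrite -(HZ c _ c0 (integral_kernel_mge0 k hf)); apply: eq_integral => w _.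
  by case: (integral_like_integral (k (X w))) => -> //; exact: ms.
- rewrite -(HD _ _ (integral_kernel_mge0 k hf) (integral_kernel_mge0 k hg)).
  apply: eq_integral => w _.
  by case: (integral_like_integral (k (X w))) => _ -> //; exact: ms.
- rewrite -(HL _ (fun n => integral_kernel_mge0 k (hf n))).
    apply: eq_integral => w _.
    case: (integral_like_integral (k (X w))) => _ _ -> // n; exact: ms.
  move=> x a b ab; apply: ge0_le_integral => //.
  - by move=> y _; case: (hf a).
  - by case: (ms _ x (hf a)).
  - by case: (ms _ x (hf b)).
  - by move=> y _; exact: ndf.
Qed.

End integral_like_instances.

(** Taken with the second projection, it lets a functional on functions of [(x, y)] act on functions
    of [y] alone. *)
Lemma integral_like_comp d d' (T : measurableType d) (T' : measurableType d')
    (R : realType) (p : T' -> T) (Phi : (T' -> \bar R) -> \bar R) :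
  measurable_fun setT p -> integral_like Phi ->
  integral_like (fun f : T -> \bar R => Phi (f \o p)).
Proof.
move=> mp [HZ HD HL].
have hp (f : T -> \bar R) : mge0 f -> mge0 (f \o p).
  by move=> [mf f0]; split => [|x]; [exact: measurableT_comp|exact: f0].
split; [move=> c f c0 hf|move=> f g hf hg|move=> f_ hf ndf].
- by rewrite -HZ//; exact: hp.
- by rewrite -HD//; exact: hp.
- by rewrite -HL//= => n; exact: hp.
Qed.

Lemma eq_indic {R : pzRingType} {T T' : Type} (A : set T) (B : set T') x y :
  (A x <-> B y) -> \1_A x = \1_B y :> R.
Proof.
move=> AB; rewrite !indicE; congr (_%:R); congr nat_of_bool.
by apply/idP/idP => /set_mem/AB ?; exact/mem_set.
Qed.

Lemma integral_preimage {R : realType} {d : measure_display} {T : measurableType d}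
    {TX : Type} (mu : {measure set T -> \bar R}) (X : T -> TX) (A : set TX)
    (f : T -> \bar R) :
  (\int[mu]_(w in X @^-1` A) f w = \int[mu]_w ((\1_A (X w))%:E * f w))%E.
Proof.
rewrite integral_mkcond; apply: eq_integral => w _.
rewrite patchE indicE; have [wA|wA] := pselect (A (X w)).
  by rewrite !mem_set// mul1e.
by rewrite !memNset// mul0e.
Qed.

(** * Conditional expectations and regular conditional distributions *)

Section conditional_expectation.
Local Open Scope ereal_scope.
Context {R : realType} {d dX : measure_display} {T : measurableType d}
  {TX : measurableType dX}.
Variables (P : probability T R) (X : T -> TX) (mX : measurable_fun setT X).

(** [regular_cond_dist] is the case of the indicator of a measurable rectangle, and rectangles form
    a pi-system that generates the product sigma-algebra. *)
Lemma integral_regular_cond_dist {dY} {TY : measurableType dY} (Y : T -> TY)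
    (k : R.-pker TX ~> TY) (f : TX * TY -> \bar R) :
  measurable_fun setT Y -> regular_cond_dist P X Y k -> mge0 f ->
  \int[P]_w f (X w, Y w) = \int[P]_w \int[k (X w)]_y f (X w, y).
Proof.
move=> mY hk hf.
have m1 : mge0 (EFin \o (fun=> 1%R : R) : T -> \bar R) by apply: mge0_cst; rewrite lee_fin.
have mXY : measurable_fun setT (fun w => (X w, Y w)) by exact: measurable_fun_pair.
have HPhi := integral_like_weight P measurableT m1 mXY.
have HPsi := integral_like_kernel P measurableT m1 k mX.
transitivity (\int[P]_w (f (X w, Y w) * 1%:E)).
  by apply: eq_integral => w _; rewrite mule1.
transitivity (\int[P]_w ((\int[k (X w)]_y f (X w, y)) * 1%:E)); last first.
  by apply: eq_integral => w _; rewrite mule1.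
apply: (eq_integral_like_setI HPhi HPsi (measurable_prod_measurableType _ _)) => //.
- move=> _ _ [A1 mA1 [A2 mA2 <-]] [B1 mB1 [B2 mB2 <-]].
  exists (A1 `&` B1); first exact: measurableI.
  by exists (A2 `&` B2); [exact: measurableI|rewrite setXI].
- by exists setT => //; exists setT => //; rewrite setXTT.
- move=> _ [A mA [B mB <-]].
  have mXA : measurable (X @^-1` A) by exact: (preimage_measurable mX).
  have mYB : measurable (Y @^-1` B) by exact: (preimage_measurable mY).
  transitivity (P (X @^-1` A `&` Y @^-1` B)).
    rewrite -[X in P X]setIT -integral_indic//; last exact: measurableI.
    by apply: eq_integral => w _; rewrite mule1; congr EFin; exact: eq_indic.
  rewrite hk// [LHS]integral_mkcond; apply: eq_integral => w _; rewrite mule1 patchE.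
  case: ifPn => [wA|wA].
    rewrite -[in LHS](setIT B) -integral_indic//; apply: eq_integral => y _.
    by congr EFin; apply: eq_indic; move: wA; rewrite inE/= => wA; split => [|[]].
  rewrite integral0_eq// => y _; rewrite indicE memNset// => -[/= wA' _].
  by move: wA; rewrite notin_setE.
- under eq_integral do rewrite mule1.
  by rewrite integral_cst// mul1e (le_lt_trans (probability_le1 P measurableT))// ltry.
- by move=> A mA; apply: integral_ge0 => w _; rewrite mule1 lee_fin.
Qed.

(** The kernel inside [cond_law] is known only through [L], so the inner integral is prescribed for
    every measure of mass 1 that satisfies [L]. *)
Lemma cond_lawE {dY} {TY : measurableType dY} (Y : T -> TY)
    (L : TX -> (set TY -> \bar R) -> Prop) (f : TX * TY -> \bar R)
    (g : TX -> \bar R) :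
  measurable_fun setT Y -> cond_law P X Y L -> mge0 f -> mge0 g ->
  {ae P, forall w, forall mu : {measure set TY -> \bar R}, mu setT = 1 ->
    L (X w) mu -> \int[mu]_y f (X w, y) = g (X w)} ->
  \int[P]_w f (X w, Y w) = \int[P]_w g (X w).
Proof.
move=> mY [k [hk Lk]] hf [mg g0] fg; rewrite (integral_regular_cond_dist mY hk hf).
have [mfk fk0] := integral_kernel_mge0 k hf.
apply: ge0_ae_eq_integral => //.
- exact: measurableT_comp mfk mX.
- exact: measurableT_comp.
apply: filterS2 Lk fg => w Lw fgw _.
by apply: fgw => //; exact: prob_kernel.
Qed.

(** The defining identity of conditional expectation: for measurable [H], [H \o X] is a version of
    the expectation of [U] given [X]. *)
Definition cexp (U : T -> R) (H : TX -> R) : Prop := forall A, measurable A ->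
  \int[P]_(w in X @^-1` A) (U w)%:E = \int[P]_(w in X @^-1` A) (H (X w))%:E.

(** [fine] yields the real-valued functions that [cond_prob] takes; it loses nothing on
    [unit_valued] functions, by [kexpK]. *)
Definition kexp {dY} {TY : measurableType dY} (k : R.-pker TX ~> TY) (f : TY -> R)
  (x : TX) : R := fine (\int[k x]_y (f y)%:E).

Lemma eq_cexp U U' H H' : U =1 U' -> H =1 H' -> cexp U H -> cexp U' H'.
Proof. by move=> /funext -> /funext ->. Qed.

Lemma cexp_integral U H (f : TX -> \bar R) : mge0 (EFin \o U) ->
  mge0 (EFin \o H) -> mge0 f -> cexp U H ->
  \int[P]_w (f (X w) * (U w)%:E) = \int[P]_w (f (X w) * (H (X w))%:E).
Proof.
move=> mU [mH H0] hf UH.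
have mHX : mge0 (EFin \o (H \o X)).
  split => [|w]; last exact: H0.
  exact: (@measurableT_comp _ _ _ _ _ _ (EFin \o H) _ X).
apply: (eq_integral_like (integral_like_weight P measurableT mU mX)
  (integral_like_weight P measurableT mHX mX)) => // A mA.
by rewrite -!integral_preimage; exact: UH.
Qed.

Section kexp.
Context {dY : measure_display} {TY : measurableType dY}.
Variable k : R.-pker TX ~> TY.

(** The range [0, 1] is stable under products and under integration against a probability kernel, so
    conditional expectations stay finite. *)
Definition unit_valued {d0} {T0 : measurableType d0} (f : T0 -> R) :=
  measurable_fun setT f /\ forall y, (0 <= f y <= 1)%R.

Lemma unit_valued_mge0 {d0} {T0 : measurableType d0} (f : T0 -> R) :
  unit_valued f -> mge0 (EFin \o f).
Proof. by move=> [mf f01]; apply: mge0_EFin => // y; case/andP: (f01 y). Qed.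

Lemma unit_valued_indic {d0} {T0 : measurableType d0} (B : set T0) :
  measurable B -> unit_valued (\1_B : T0 -> R).
Proof.
move=> mB; split; first exact: measurable_indic.
by move=> y; rewrite indicE; case: (_ \in _); rewrite /= ?lexx ?ler01.
Qed.

Lemma unit_valuedM {d0} {T0 : measurableType d0} (f g : T0 -> R) :
  unit_valued f -> unit_valued g -> unit_valued (fun x => f x * g x)%R.
Proof.
move=> [mf f01] [mg g01]; split; first exact: measurable_funM.
move=> x; have /andP[f0 f1] := f01 x; have /andP[g0 g1] := g01 x.
by rewrite mulr_ge0//= mulr_ile1.
Qed.

Lemma unit_valued_comp {d0 d1} {T0 : measurableType d0} {T1 : measurableType d1}
    (f : T0 -> R) (Y : T1 -> T0) :
  measurable_fun setT Y -> unit_valued f -> unit_valued (f \o Y).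
Proof. by move=> mY [mf f01]; split => [|x]; [exact: measurableT_comp|exact: f01]. Qed.

Lemma kexpK f x : unit_valued f -> (kexp k f x)%:E = \int[k x]_y (f y)%:E.
Proof.
move=> hf; have [mf f0] := unit_valued_mge0 hf; rewrite /kexp fineK//.
rewrite ge0_fin_numE; last by apply: integral_ge0 => y _; exact: f0.
apply: (@le_lt_trans _ _ (\int[k x]_y (1 : \bar R))).
  by apply: ge0_le_integral => // y _; rewrite ?lee_fin//; case: hf => _ /(_ y)/andP[].
by rewrite integral_cst// mul1e prob_kernel ltry.
Qed.

Lemma unit_valued_kexp f : unit_valued f -> unit_valued (kexp k f).
Proof.
move=> hf; have [mf f0] := unit_valued_mge0 hf; split.
  apply/measurable_EFinP; rewrite (_ : _ \o _ = fun x => \int[k x]_y (f y)%:E).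
    by apply: (measurable_fun_integral_kernel (measurable_kernel k)).
  by apply/funext => x; exact: kexpK.
move=> x; rewrite -!lee_fin kexpK//; apply/andP; split.
  by apply: integral_ge0 => y _; exact: f0.
apply: (@le_trans _ _ (\int[k x]_y (1 : \bar R))); last first.
  by rewrite integral_cst// mul1e prob_kernel.
by apply: ge0_le_integral => // y _; rewrite ?lee_fin//; case: hf => _ /(_ y)/andP[].
Qed.

Lemma cond_prob_kexp (Y : T -> TY) B : measurable B -> regular_cond_dist P X Y k ->
  cond_prob P X (Y @^-1` B) (kexp k \1_B).
Proof.
move=> mB hk; split; first by case: (unit_valued_kexp (unit_valued_indic mB)).
move=> A mA; rewrite hk//; apply: eq_integral => w _.
by rewrite kexpK ?integral_indic ?setIT//; exact: unit_valued_indic.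
Qed.

(** With [U] and [H] held fixed, both sides are integral-like in [f], so indicators of events of [Y]
    suffice. *)
Lemma cexp_kexp (Y : T -> TY) U H (f : TY -> R) : measurable_fun setT Y ->
  unit_valued U -> unit_valued H -> unit_valued f ->
  (forall B, measurable B -> cexp (fun w => \1_B (Y w) * U w)%R
                                  (fun x => kexp k \1_B x * H x)%R) ->
  cexp (fun w => f (Y w) * U w)%R (fun x => kexp k f x * H x)%R.
Proof.
move=> mY hU hH hf base A mA.
have mXA : measurable (X @^-1` A) by exact: (preimage_measurable mX).
have HPhi := integral_like_weight P mXA (unit_valued_mge0 hU) mY.
have HPsi := integral_like_comp (@measurable_snd _ _ TX TY)
  (integral_like_kernel P mXA (unit_valued_mge0 (unit_valued_comp mX hH)) k mX).
have kE (g : TY -> R) : unit_valued g ->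
  \int[P]_(w in X @^-1` A) ((\int[k (X w)]_y (g y)%:E) * (H (X w))%:E) =
  \int[P]_(w in X @^-1` A) (kexp k g (X w) * H (X w))%:E.
  by move=> hg; apply: eq_integral => w _; rewrite EFinM kexpK.
rewrite -kE//; apply: (eq_integral_like HPhi HPsi _ (unit_valued_mge0 hf)) => B mB.
by rewrite /= kE ?base//; exact: unit_valued_indic.
Qed.

End kexp.

End conditional_expectation.

(** * Conditional independence, from events to functions *)

Section conditional_independence.
Context {R : realType} {d dX : measure_display} {T : measurableType d}
  {TX : measurableType dX}.
Variables (P : probability T R) (X : T -> TX) (mX : measurable_fun setT X).

Lemma cond_prob_cexp (E : set T) (g : TX -> R) : measurable E ->
  cond_prob P X E g -> cexp P X \1_E g.
Proof.
move=> mE [_ hE] A mA.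
have mXA : measurable (X @^-1` A) by exact: (preimage_measurable mX).
by rewrite integral_indic// setIC; exact: hE.
Qed.

Lemma cond_indep_cexp n (F : n.-tuple (set_system T)) (E : 'I_n -> set T)
    (g : 'I_n -> TX -> R) : cond_indep P X F ->
  (forall i, measurable (E i)) ->
  (forall i, tnth F i (E i)) -> (forall i, cond_prob P X (E i) (g i)) ->
  cexp P X (fun w => \prod_(i < n) \1_(E i) w) (fun x => \prod_(i < n) g i x).
Proof.
move=> FI mE FE Eg.
have mI : measurable (\bigcap_i E i).
  by apply: fin_bigcap_measurable.
apply: eq_cexp (cond_prob_cexp mI (FI E FE g Eg)) => // w.
have [wE|wE] := pselect ((\bigcap_i E i) w).
  by rewrite indicE mem_set// big1// => i _; rewrite indicE mem_set//; exact: wE.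
rewrite indicE memNset//.
have [i wi] : exists i, ~ E i w by apply/existsNP => h; apply: wE => i _; exact: h.
by rewrite (bigD1 i)//= indicE memNset// mul0r.
Qed.

Lemma unit_valued_prod {d0} {T0 : measurableType d0} (I : Type) (s : seq I)
    (Q : pred I) (f : I -> T0 -> R) : (forall i, unit_valued (f i)) ->
  unit_valued (fun x => \prod_(i <- s | Q i) f i x).
Proof.
move=> hf; elim: s => [|i s IH].
  under eq_fun do rewrite big_nil.
  by split => [|y]; [exact: measurable_cst|rewrite ler01 lexx].
under eq_fun do rewrite big_cons.
by case: (Q i) => //; exact: unit_valuedM.
Qed.

(** [h \o X] is a version of the conditional expectation of the
    [S]-measurable variable [u]; moreover a product formula involving [u] follows
    from the same formula for the events of [S], which lets [cond_indep_prod]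
    replace indicators by functions one factor at a time. *)
Definition cond_version (S : set_system T) (u : T -> R) (h : TX -> R) : Prop :=
  [/\ unit_valued u, unit_valued h &
    forall U H, unit_valued U -> unit_valued H ->
      (forall E g, measurable E -> S E -> cond_prob P X E g -> unit_valued g ->
        cexp P X (fun w => \1_E w * U w) (fun x => g x * H x)) ->
      cexp P X (fun w => u w * U w) (fun x => h x * H x)].

(** By [cexp_kexp] it is enough to test events of [Y]. [S] may be larger than the sigma-algebra of
    [Y], as happens for the pair inside the triple with [V6]. *)
Lemma cond_version_kexp {dY} {TY : measurableType dY} (Y : T -> TY)
    (k : R.-pker TX ~> TY) (S : set_system T) (f : TY -> R) :
  measurable_fun setT Y -> regular_cond_dist P X Y k ->
  (forall B, measurable B -> S (Y @^-1` B)) -> unit_valued f ->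
  cond_version S (fun w => f (Y w)) (kexp k f).
Proof.
move=> mY hk SY hf; split; [exact: unit_valued_comp|exact: unit_valued_kexp|].
move=> U H hU hH base; apply: cexp_kexp => // B mB.
have mYB : measurable (Y @^-1` B) by exact: (preimage_measurable mY).
have := base _ _ mYB (SY B mB) (cond_prob_kexp mB hk)
  (unit_valued_kexp k (unit_valued_indic mB)).
by apply: eq_cexp => // w; congr (_ * _); exact: eq_indic.
Qed.

(** Induction on the number of replaced factors: indices below [m] carry [u] and [h], the others
    still carry events and versions of their conditional probabilities. *)
Lemma cond_indep_prod n (F : n.-tuple (set_system T)) (u : 'I_n -> T -> R)
    (h : 'I_n -> TX -> R) : cond_indep P X F -> (forall i, tnth F i setT) ->
  (forall i, cond_version (tnth F i) (u i) (h i)) ->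
  cexp P X (fun w => \prod_(i < n) u i w) (fun x => \prod_(i < n) h i x).
Proof.
move=> FI FT Fuh.
pose valid E g := forall i, [/\ measurable (E i), tnth F i (E i),
  cond_prob P X (E i) (g i) & unit_valued (g i)].
(* The families [E] and [g] stay universally quantified because the induction step changes the event
   at index [m]. *)
suff main m E g : valid E g -> cexp P X
    (fun w => \prod_(i < n) (if (i < m)%N then u i w else \1_(E i) w))
    (fun x => \prod_(i < n) (if (i < m)%N then h i x else g i x)).
  (* At stage [n] no event is left, and any valid family will do; here the whole space with version
     1. *)
  have hE : valid (fun=> setT) (fun=> cst 1).
    move=> i; split => //; last first.
      by split => [|x]; [exact: measurable_cst|rewrite ler01 lexx].
    split => [|A mA]; first exact: measurable_cst.
    have mXA : measurable (X @^-1` A) by exact: (preimage_measurable mX).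
    by rewrite setIT (integral_cst P mXA 1) mul1e.
  apply: eq_cexp (main n _ _ hE) => w; by apply: eq_bigr => i _; rewrite ltn_ord.
elim: m E g => [|m IH] E g hE.
  by apply: cond_indep_cexp FI _ _ _ => i; case: (hE i).
have [nm|mn] := leqP n m.
  apply: eq_cexp (IH E g hE) => w; apply: eq_bigr => i _;
  by rewrite ltnS (leq_trans _ nm) ?(leq_trans _ (leqnSn m))// ltnW// (leq_trans _ nm).
pose j := Ordinal mn.
(* The factors other than [j] are common to the stages [m] and [m.+1]. *)
pose U w := \prod_(i < n | i != j) (if (i < m)%N then u i w else \1_(E i) w).
pose H x := \prod_(i < n | i != j) (if (i < m)%N then h i x else g i x).
have jE (a b : 'I_n -> R) :
    \prod_(i < n) (if (i < m.+1)%N then a i else b i) =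
    a j * \prod_(i < n | i != j) (if (i < m)%N then a i else b i).
  rewrite (bigD1 j)//= ltnSn; congr (_ * _); apply: eq_bigr => i ij.
  by rewrite ltnS leq_eqVlt (_ : (i == m :> nat) = false)//; apply/negbTE.
apply: (@eq_cexp _ _ _ _ _ _ _ (fun w => u j w * U w) _ (fun x => h j x * H x)).
- by move=> w; rewrite (jE (u ^~ w) (fun i => \1_(E i) w)).
- by move=> x; rewrite (jE (h ^~ x) (g ^~ x)).
have [uj hj ext] := Fuh j; apply: (ext U H).
- apply: (@unit_valued_prod _ _ _ (index_enum 'I_n) (fun i => i != j)
    (fun i w => if (i < m)%N then u i w else \1_(E i) w)) => i.
  case: (i < m)%N; first by case: (Fuh i).
  by apply: unit_valued_indic; case: (hE i).
- apply: (@unit_valued_prod _ _ _ (index_enum 'I_n) (fun i => i != j)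
    (fun i x => if (i < m)%N then h i x else g i x)) => i.
  by case: (i < m)%N; [case: (Fuh i)|case: (hE i)].
move=> E' g' mE' FE' Eg' hg'.
(* With the test event [E'] placed at index [j], the product formula to be tested is the induction
   hypothesis. *)
pose E2 i := if i == j then E' else E i; pose g2 i := if i == j then g' else g i.
have h2 : valid E2 g2.
  by move=> i; rewrite /E2 /g2; case: eqP => [->|_]; [split|exact: hE].
apply: eq_cexp (IH _ _ h2) => w; rewrite (bigD1 j)//= ltnn /E2 /g2 eqxx;
by congr (_ * _); apply: eq_bigr => i /negbTE ->.
Qed.

End conditional_independence.

(** The map [j] is needed because Lebesgue measure lives on [measurableTypeR R],
    whose measurable structure is not convertible to the one of [R]. *)
Lemma integral_density {R : realType} {d d'} {T : measurableType d}
    {T' : measurableType d'} (nu : {measure set T -> \bar R})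
    (mu : {measure set T' -> \bar R}) (j : T -> T') (g : T -> R) (f : T' -> \bar R) :
  measurable_fun setT j -> mge0 (EFin \o g) -> mge0 f ->
  (forall B, measurable B -> mu B = \int[nu]_(x in j @^-1` B) (g x)%:E)%E ->
  (\int[mu]_x f x = \int[nu]_x (f (j x) * (g x)%:E))%E.
Proof.
move=> mj hg hf muE.
apply: (eq_integral_like (integral_like_integral mu)
  (integral_like_weight nu measurableT hg mj) _ hf) => B mB.
by rewrite integral_indic// setIT muE// -integral_preimage.
Qed.

(** * Laplace transforms of gamma laws *)

Section gamma_laplace.
Context {R : realType}.
Local Notation leb := (@lebesgue_measure R).

(** The image of Lebesgue measure under multiplication by [c], scaled by [c], gives half-open
    intervals their length, and this property determines Lebesgue measure. *)
Lemma integral_scale (c : R) (f : R -> \bar R) : 0 < c -> mge0 f ->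
  (\int[leb]_x f x = c%:E * \int[leb]_x f (c * x)%R)%E.
Proof.
move=> c0 [mf f0].
have mc : measurable_fun setT (fun x : measurableTypeR R => c * x : measurableTypeR R)%R.
  exact: measurable_funM.
pose phi (x : measurableTypeR R) : measurableTypeR R := c * x.
pose nu0 := mscale (NngNum (ltW c0)) (pushforward leb phi).
pose nu := nu0 mc.
have nuE A : measurable A -> leb A = nu A.
  apply: lebesgue_measure_unique => _ [[a b] _ <-].
  change (leb `]a, b]%classic = c%:E * leb (phi @^-1` `]a, b]%classic))%E.
  have -> : phi @^-1` `]a, b] = `]a / c, b / c]%classic.
    apply/seteqP; split => x /=; rewrite /phi !in_itv/= ltr_pdivrMr// ler_pdivlMr//;
    by rewrite mulrC.
  rewrite !lebesgue_measure_itv/= !lte_fin ltr_pM2r ?invr_gt0//.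
  case: ifP => _; last by rewrite mule0.
  by rewrite -!EFinD -EFinM; congr EFin; field; rewrite gt_eqF.
rewrite (eq_measure_integral nu); last by move=> A mA _; exact: nuE.
by rewrite ge0_integral_mscale//= ge0_integral_pushforward.
Qed.

Lemma measurable_gamma_pdf (a s : R) : measurable_fun setT (gamma_pdf a s).
Proof.
apply: measurable_fun_ifT => //; first exact: measurable_fun_ltr.
apply: measurable_funM => //; apply: measurable_funM => //.
by apply: measurableT_comp => //; apply: measurable_funN; exact: measurable_funM.
Qed.

Lemma gamma_pdf_ge0 (a s x : R) : 0 <= gamma_pdf a s x.
Proof.
rewrite /gamma_pdf; case: ifP => // _; apply: divr_ge0.
  by rewrite mulr_ge0// ?powR_ge0 ?expR_ge0.
rewrite mulr_ge0 ?powR_ge0//; apply: Rintegral_ge0 => y _.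
by rewrite mulr_ge0 ?powR_ge0 ?expR_ge0.
Qed.

Lemma mge0_gamma_pdf (a s : R) : mge0 (EFin \o gamma_pdf a s).
Proof. by apply: mge0_EFin; [exact: measurable_gamma_pdf|exact: gamma_pdf_ge0]. Qed.

Lemma gamma_pdf_scale (a s x : R) : 0 < a ->
  gamma_pdf 1 s x = a * gamma_pdf a s (a * x).
Proof.
move=> a0; rewrite /gamma_pdf pmulr_rgt0//; case: ifP => x0; last by rewrite mulr0.
rewrite powR1 mulr1 divr1 powRM ?ltW// (_ : a * x / a = x); last by field; rewrite gt_eqF.
have -> : a `^ s = a `^ (s - 1) * a.
  by rewrite -{3}(powRr1 (ltW a0)) -powRD ?subrK// (gt_eqF a0) implybT.
have as0 : a `^ (s - 1) != 0 by rewrite gt_eqF// powR_gt0.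
(* If [gamma_fun s] were 0, its inverse would be 0 and both sides would vanish; otherwise [field]
   applies. *)
rewrite [in RHS]invfM [in RHS]invfM; have [->|g0] := eqVneq (gamma_fun s) 0.
  by rewrite !invr0 !(mulr0, mul0r).
by field; rewrite g0 as0 gt_eqF.
Qed.

Lemma integral_gamma_pdf_scale (a b s : R) : 0 < a -> 0 < b ->
  (\int[leb]_x (gamma_pdf a s x)%:E = \int[leb]_x (gamma_pdf b s x)%:E)%E.
Proof.
suff H c : 0 < c ->
    (\int[leb]_x (gamma_pdf c s x)%:E = \int[leb]_x (gamma_pdf 1 s x)%:E)%E.
  by move=> a0 b0; rewrite !H.
move=> c0; rewrite (integral_scale c0 (mge0_gamma_pdf _ _)).
rewrite -ge0_integralZl//.
- by apply: eq_integral => x _; rewrite -EFinM -gamma_pdf_scale.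
- apply/measurable_EFinP/measurableT_comp; first exact: measurable_gamma_pdf.
  exact: measurable_funM.
- by move=> x _; rewrite lee_fin gamma_pdf_ge0.
- by rewrite lee_fin ltW.
Qed.

(** Exponential tilting: the scale [a] becomes [a / (1 + a * t)], and the ratio of the normalizing
    constants is the Laplace transform. *)
Lemma gamma_pdf_expR (a s t x : R) : 0 < a -> 0 <= t ->
  expR (- (t * x)) * gamma_pdf a s x =
  (1 + a * t) `^ (- s) * gamma_pdf (a / (1 + a * t)) s x.
Proof.
move=> a0 t0; rewrite /gamma_pdf; case: ifP => x0; last by rewrite !mulr0.
have c0 : 0 < 1 + a * t by rewrite ltr_wpDr// mulr_ge0// ltW.
have an0 : a != 0 by rewrite gt_eqF.
have cn0 : 1 + a * t != 0 by rewrite gt_eqF.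
have -> : - (x / (a / (1 + a * t))) = - (x / a) + - (t * x) by field; rewrite an0.
rewrite expRD powRM ?invr_ge0 ?ltW// -[(1 + a * t)^-1]powR_inv1 ?ltW//.
rewrite -powRrM mulN1r.
have as0 : a `^ s != 0 by rewrite gt_eqF// powR_gt0.
have cs0 : (1 + a * t) `^ (- s) != 0 by rewrite gt_eqF// powR_gt0.
rewrite [in RHS]invfM [in RHS]invfM [in LHS]invfM.
have [->|g0] := eqVneq (gamma_fun s) 0; first by rewrite !invr0 !(mulr0, mul0r).
by field; rewrite g0 as0 cs0.
Qed.

(** Finiteness and positivity of Euler's integral are not needed: [mu setT = 1]
    says that the densities [gamma_pdf a' s] have total mass 1 for [a' = a], hence
    by scaling for every [a' > 0], in particular for the exponentially tilted
    density. *)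
Lemma gamma_laplace (mu : {measure set R -> \bar R}) (a s t : R) :
  0 < a -> 0 <= s -> 0 <= t -> mu setT = 1%E -> same_law (gamma_prob a s) mu ->
  (\int[mu]_x (expR (- (t * x)))%:E = ((1 + a * t) `^ (- s))%:E)%E.
Proof.
move=> a0; rewrite le_eqVlt => /predU1P[<-|s0] t0 mu1 muE.
  (* Shape 0 is the point mass at 0, where both sides are 1. *)
  rewrite (eq_measure_integral (\d_(0 : R))); last first.
    by move=> A mA _; rewrite muE// /gamma_prob ltxx.
  rewrite integral_dirac//.
    by rewrite diracT mul1e mulr0 oppr0 expR0 powRr0.
  apply/measurable_EFinP; apply: measurableT_comp => //; apply: measurable_funN.
  exact: measurable_funM.
have muE' B : measurable B -> (mu B = \int[leb]_(x in B) (gamma_pdf a s x)%:E)%E.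
  by move=> mB; rewrite muE// /gamma_prob s0.
rewrite (@integral_density _ _ _ (measurableTypeR R) R leb mu id (gamma_pdf a s)
  _ (@measurable_id _ _ setT) (mge0_gamma_pdf a s) _ muE'); last first.
  apply: mge0_EFin; last by move=> x; exact: expR_ge0.
  by apply: measurableT_comp => //; apply: measurable_funN; exact: measurable_funM.
under eq_integral do rewrite -EFinM gamma_pdf_expR// EFinM.
rewrite ge0_integralZl//; last 3 first.
- by case: (mge0_gamma_pdf (a / (1 + a * t)) s).
- by move=> x _; rewrite lee_fin gamma_pdf_ge0.
- by rewrite lee_fin powR_ge0.
rewrite (@integral_gamma_pdf_scale _ a)//; last first.
  by rewrite divr_gt0// ltr_wpDr// mulr_ge0// ltW.
by rewrite -(muE' setT)// mu1 mule1.
Qed.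

Lemma gamma_pos (mu : {measure set R -> \bar R}) (a s : R) : 0 < s ->
  same_law (gamma_prob a s) mu -> mu `]-oo, 0%R]%classic = 0%E.
Proof.
move=> s0 ->//; rewrite /gamma_prob s0 integral0_eq// => x /=.
by rewrite in_itv/= /gamma_pdf => x0; rewrite ltNge x0.
Qed.

(** Shape 0 is included, for the sake of [Y2] and [Y3], whose shapes [V1 + V4] and [V2 + V5] may
    vanish. *)
Lemma gamma_neg (mu : {measure set R -> \bar R}) (a s : R) :
  same_law (gamma_prob a s) mu -> mu `]-oo, 0%R[%classic = 0%E.
Proof.
move=> ->//; rewrite /gamma_prob; case: ifP => _.
  rewrite integral0_eq// => x /=.
  by rewrite in_itv/= /gamma_pdf => x0; rewrite ltNge ltW.
by rewrite diracE memNset//= in_itv/= ltxx.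
Qed.

(** Truncating at 0 makes the exponential [unit_valued] without changing it on
    the support of a gamma law. *)
Definition exp_max (t x : R) := expR (- (t * Num.max 0 x)).

Lemma exp_maxE t x : 0 <= x -> exp_max t x = expR (- (t * x)).
Proof. by move=> x0; rewrite /exp_max max_r. Qed.

Lemma unit_valued_exp_max t : 0 <= t -> unit_valued (exp_max t).
Proof.
move=> t0; split => [|x].
  apply: measurableT_comp => //; apply: measurable_funN; apply: measurable_funM => //.
  exact: measurable_maxr.
by rewrite expR_ge0/= -expR0 ler_expR oppr_le0 mulr_ge0// le_max lexx.
Qed.

Lemma gamma_laplace_max (mu : {measure set R -> \bar R}) (a s t : R) :
  0 < a -> 0 <= s -> 0 <= t -> mu setT = 1%E -> same_law (gamma_prob a s) mu ->
  (\int[mu]_x (exp_max t x)%:E = ((1 + a * t) `^ (- s))%:E)%E.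
Proof.
move=> a0 s0 t0 mu1 muE; rewrite -(gamma_laplace a0 s0 t0 mu1 muE).
have [mf f0] := unit_valued_mge0 (unit_valued_exp_max t0).
apply: ge0_ae_eq_integral => //; last 2 first.
- by move=> x _; rewrite lee_fin expR_ge0.
- have : {ae mu, forall x, 0 <= x}.
    exists `]-oo, 0%R[%classic; split; [exact: measurable_itv|exact: gamma_neg muE|].
    by move=> x /= /negP; rewrite in_itv/= ltNge.
  by move=> ge0; apply: filterS ge0 => x x0 _; rewrite exp_maxE.
- apply/measurable_EFinP; apply: measurableT_comp => //; apply: measurable_funN.
  exact: measurable_funM.
Qed.

End gamma_laplace.

(** * Generating functions of Poisson laws *)

Section poisson_pgf.
Context {R : realType}.

(** This form lets [integral_density] treat Poisson and gamma laws alike. *)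
Lemma poisson_count (m : R) (B : set nat) : 0 < m ->
  (poisson m B = \int[counting]_(k in B) (poisson_pmf m k)%:E)%E.
Proof.
move=> m0; rewrite /poisson /poisson_prob m0 integral_mkcond.
have p0 k : (0 <= (fun n : nat => (poisson_pmf m n)%:E) k :> \bar R)%E.
  by rewrite lee_fin poisson_pmf_ge0.
rewrite ge0_integral_count; last first.
  by move=> k; rewrite patchE; case: ifP.
rewrite nneseries_esumT; last by move=> k; rewrite patchE; case: ifP.
by rewrite esum_mkcond; apply: eq_esum => k _; rewrite patchE.
Qed.

(** The factor [r ^+ k] turns the Poisson weights of parameter [m] into those of parameter [m * r],
    up to a constant, and the new weights again have total mass 1. *)
Lemma poisson_pgf (mu : {measure set nat -> \bar R}) (m r : R) : 0 < m -> 0 < r ->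
  same_law (poisson m) mu ->
  (\int[mu]_k (r ^+ k)%:E = (expR (- (m * (1 - r))))%:E)%E.
Proof.
move=> m0 r0 muE.
rewrite (@integral_density _ _ _ _ _ counting mu id (poisson_pmf m))//; last 3 first.
- by apply: mge0_EFin => // k; exact: poisson_pmf_ge0.
- by apply: mge0_EFin => // k; rewrite exprn_ge0// ltW.
- by move=> B mB; rewrite muE// poisson_count.
have mr0 : 0 < m * r by rewrite mulr_gt0.
under eq_integral => k _.
  rewrite -EFinM (_ : _ * _ = expR (- (m * (1 - r))) * poisson_pmf (m * r) k); last first.
    rewrite /poisson_pmf m0 mr0 exprMn.
    have -> : - m = - (m * (1 - r)) + - (m * r) by ring.
    by rewrite expRD; ring.
  rewrite EFinM; over.
rewrite ge0_integralZl//; last first.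
  by move=> k _; rewrite lee_fin poisson_pmf_ge0.
by rewrite -poisson_count// /poisson probability_setT mule1.
Qed.

End poisson_pgf.

(** * Conditional laws that depend on the conditioning through an integer *)

Section kernel_of_nat.
Context {R : realType} {dX dY : measure_display} {TX : measurableType dX}
  {TY : measurableType dY}.
Variables (N : TX -> nat) (nu : nat -> probability TY R).

(** The measurability proof is an argument so that the kernel instances below attach to
    [knat mN]. *)
Definition knat of measurable_fun setT N : TX -> {measure set TY -> \bar R} :=
  fun x => nu (N x).

Hypothesis mN : measurable_fun setT N.

Let measurable_knat U : measurable U -> measurable_fun setT (knat mN ^~ U).
Proof. by move=> mU; exact: (@measurableT_comp _ _ _ _ _ _ (fun n => nu n U)). Qed.

HB.instance Definition _ := isKernel.Build _ _ _ _ _ (knat mN) measurable_knat.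

Let knat_setT x : knat mN x setT = 1%E.
Proof. exact: probability_setT. Qed.

HB.instance Definition _ :=
  Kernel_isProbability.Build _ _ _ _ _ (knat mN) knat_setT.

End kernel_of_nat.

Section cond_law_nat.
Local Open Scope ereal_scope.
Context {R : realType} {d dX dW : measure_display} {T : measurableType d}
  {TX : measurableType dX} {TW : measurableType dW}.
Variables (P : probability T R) (X : T -> TX) (W : T -> TW) (N : TX -> nat).
Hypotheses (mX : measurable_fun setT X) (mW : measurable_fun setT W)
  (mN : measurable_fun setT N).

(** The expectation of [F \o W] given [X] has a version that factors through [N]. *)
Definition cexp_nat (F : TW -> \bar R) (c : nat -> \bar R) : Prop :=
  forall A, measurable A ->
  \int[P]_(w in X @^-1` A) F (W w) = \int[P]_(w in X @^-1` A) c (N (X w)).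

Let S n := (N \o X) @^-1` [set n].

Let mS n : measurable (S n).
Proof. by rewrite -[S n]setTI; apply: (measurableT_comp mN mX). Qed.

Let W_mixin := isMeasurableFun.Build _ _ _ _ _ mW.
Let W_mfun : {mfun T >-> TW} := HB.pack W W_mixin.

(** The law of [W] given [N \o X = n]; [mnormalize] returns its default [P], here
    a junk value, when this event is null. *)
Definition law_given n : probability TW R :=
  distribution (mnormalize (mrestr P (mS n)) P) W_mfun.

(** On the event [S n] the conditional expectation is the constant [c n], so averaging over this
    event returns it. *)
Lemma integral_law_given n F c : mge0 F -> cexp_nat F c -> P (S n) != 0 ->
  \int[law_given n]_y F y = c n.
Proof.
move=> hF Fc Sn0; have [mF F0] := hF.
have Sfin : P (S n) \is a fin_num by exact: fin_num_measure.
pose p := fine (P (S n)).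
have pE : P (S n) = p%:E by rewrite fineK.
have p0 : (0 < p)%R by rewrite -lte_fin -pE lt0e Sn0 measure_ge0.
(* This function is the density of [law_given n], before transport by [W], with respect to [P]. *)
have hg : mge0 (EFin \o (fun w => p^-1 * \1_(S n) w)%R : T -> \bar R).
  apply: mge0_EFin; first by apply: measurable_funM => //; exact: measurable_indic.
  by move=> w; rewrite mulr_ge0// invr_ge0 ltW.
rewrite (@integral_density _ _ _ _ _ P _ W _ _ mW hg hF); last first.
  move=> B mB.
  have mWB : measurable (W @^-1` B) by exact: (preimage_measurable mW).
  under eq_integral do rewrite EFinM.
  rewrite ge0_integralZl//; last 2 first.
  - by apply/measurable_EFinP; apply: measurable_funTS; exact: measurable_indic.
  - by rewrite lee_fin invr_ge0 ltW.
  rewrite integral_indic//.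
  have T1 : mrestr P (mS n) [set: T] = p%:E by rewrite /mrestr setTI.
  transitivity (mnormalize (mrestr P (mS n)) P (W @^-1` B)); first by [].
  (* The mass [p] is neither 0 nor infinite, so the default branch of [mnormalize] is excluded. *)
  rewrite /mnormalize; case: ifPn => [/orP[]/eqP h|_].
  - by have [h0] := etrans (esym T1) h; rewrite h0 ltxx in p0.
  - by have := etrans (esym T1) h.
  by rewrite muleC setIC; congr (_%:E * _); congr (_^-1)%R; exact: (congr1 fine T1).
have -> : \int[P]_x (F (W x) * (p^-1 * \1_(S n) x)%:E) =
    p^-1%:E * \int[P]_(x in S n) F (W x).
  rewrite [in RHS]integral_preimage -ge0_integralZl//.
  - apply: eq_integral => w _; rewrite EFinM muleC -muleA.
    by congr (_ * (_ * _)); congr EFin; exact: eq_indic.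
  - apply: emeasurable_funM; last exact: measurableT_comp.
    apply/measurable_EFinP.
    apply: (@measurableT_comp _ _ _ _ _ _ (\1_[set n] : nat -> R)) => //.
    exact: measurableT_comp.
  - by move=> w _; rewrite mule_ge0.
  - by rewrite lee_fin invr_ge0 ltW.
have mNn : measurable (N @^-1` [set n]) by exact: (preimage_measurable mN).
have := Fc _ mNn => ->.
transitivity (p^-1%:E * \int[P]_(w in S n) (cst (c n)) w).
  by congr (_ * _); apply: eq_integral => w; rewrite inE /S/= => ->.
rewrite integral_cst//= pE muleCA -EFinM mulVf ?gt_eqF// mule1//.
Qed.

(** A single null set, the union of the null events [S n], serves all pairs [F], [c] at once.
    Laplace transforms at uncountably many points therefore hold together almost surely. *)
Lemma cond_law_nat :
  (forall B, measurable B -> exists c, cexp_nat (fun y => (\1_B y)%:E) c) ->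
  exists k : R.-pker TX ~> TW, regular_cond_dist P X W k /\
    {ae P, forall w, forall F c, mge0 F -> cexp_nat F c ->
      \int[k (X w)]_y F y = c (N (X w))}.
Proof.
move=> Bc; exists (knat law_given mN).
have ae0 : {ae P, forall w, P (S (N (X w))) != 0}.
  pose S0 n := if P (S n) == 0 then S n else set0.
  suff : P.-negligible (\bigcup_n S0 n).
    apply: negligibleS.
    by move=> w /= /negP; rewrite negbK => w0; exists (N (X w)) => //; rewrite /S0 w0.
  apply: negligible_bigcup => n; rewrite /S0; case: eqP => Sn0.
    by exists (S n); split.
  exact: negligible_set0.
have aeE : {ae P, forall w, forall F c, mge0 F -> cexp_nat F c ->
      \int[knat law_given mN (X w)]_y F y = c (N (X w))}.
  by apply: filterS ae0 => w w0 F c hF Fc; exact: integral_law_given.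
split => // A B mA mB.
have [c cB] := Bc B mB.
have mXA : measurable (X @^-1` A) by exact: (preimage_measurable mX).
have mWB : measurable (W @^-1` B) by exact: (preimage_measurable mW).
transitivity (\int[P]_(w in X @^-1` A) (\1_B (W w))%:E).
  rewrite setIC -(integral_indic P mXA mWB); apply: eq_integral => w _.
  by rewrite (eq_indic (B := B) (y := W w)).
rewrite (cB A mA); apply: ae_eq_integral => //.
- apply: measurable_funTS; apply: (@measurableT_comp _ _ _ _ _ _ c) => //.
  exact: measurableT_comp.
- apply: measurable_funTS.
  apply: (@measurableT_comp _ _ _ _ _ _ (fun x => knat law_given mN x B)) => //.
  exact: measurable_kernel.
apply: filterS aeE => w h _.
by rewrite -(h _ _ (mge0_indic mB) cB) integral_indic// setIT.
Qed.

End cond_law_nat.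

(** A preimage splits into countably many slices, one for each integer. *)
Lemma measurable_fun_prod_nat {d d'} {T : measurableType d} {U : measurableType d'}
    (f : T * nat -> U) :
  (forall n, measurable_fun setT (fun x => f (x, n))) -> measurable_fun setT f.
Proof.
move=> mf _ B mB; rewrite setTI.
have -> : f @^-1` B = \bigcup_n (((fun x => f (x, n)) @^-1` B) `*` [set n]).
  apply/seteqP; split => [[x n] /= fB|[x n] [m _ [/= fB ->]]//].
  by exists n.
apply: bigcup_measurable => n _; apply: measurableX => //.
exact: (preimage_measurable (mf n)).
Qed.

Lemma mge0_comp {R : realType} {d d'} {T : measurableType d} {U : measurableType d'}
    (f : U -> \bar R) (p : T -> U) :
  mge0 f -> measurable_fun setT p -> mge0 (f \o p).
Proof. by move=> [mf f0] mp; split => [|x]; [exact: measurableT_comp|exact: f0]. Qed.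

Lemma cond_law_null {R : realType} {d dX dY} {T : measurableType d}
    {TX : measurableType dX} {TY : measurableType dY} (P : probability T R)
    (X : T -> TX) (Y : T -> TY) (L : TX -> (set TY -> \bar R) -> Prop) (B : set TY) :
  measurable_fun setT X -> measurable_fun setT Y -> cond_law P X Y L ->
  measurable B ->
  (forall x (mu : {measure set TY -> \bar R}), L x mu -> mu B = 0%E) ->
  {ae P, forall w, ~ B (Y w)}.
Proof.
move=> mX mY HL mB LB.
have hf : mge0 (fun xy : TX * TY => (\1_B xy.2)%:E : \bar R).
  exact: (mge0_comp (mge0_indic mB)).
have mYB : measurable (Y @^-1` B) by exact: (preimage_measurable mY).
have E : (\int[P]_w (fun xy : TX * TY => (\1_B xy.2)%:E) (X w, Y w) =
    \int[P]_w (fun=> 0) (X w))%E.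
  apply: (cond_lawE mX mY HL hf (mge0_cst (lexx 0%E))).
  by apply: aeW => w mu mu1 muE; rewrite integral_indic// setIT; exact: LB muE.
exists (Y @^-1` B); split => //; last by move=> w /= /contrapT.
rewrite -[Y @^-1` B]setIT -integral_indic//; move: E; rewrite integral0 => <-.
by apply: eq_integral => w _; congr EFin; exact: eq_indic.
Qed.

Lemma gamma_cond_ge0 {R : realType} {d dX} {T : measurableType d}
    {TX : measurableType dX} (P : probability T R) (X : T -> TX) (Y : T -> R)
    (a : R) (s : TX -> R) :
  measurable_fun setT X -> measurable_fun setT Y ->
  cond_law P X Y (fun x => same_law (gamma_prob a (s x))) ->
  {ae P, forall w, 0 <= Y w}.
Proof.
move=> mX mY HL.
have := cond_law_null mX mY HL (measurable_itv `]-oo, 0[)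
  (fun x mu => @gamma_neg _ mu a (s x)).
by move=> H; apply: filterS H => w /negP; rewrite in_itv/= -leNgt.
Qed.

(** * The conditional law of the pair [(Z2, Z3)] *)

Section pair_kernel.
Local Open Scope ereal_scope.
Context {R : realType} {d dG : measure_display} {T : measurableType d}
  {TG : measurableType dG}.
Variables (P : probability T R) (G : T -> TG) (N : TG -> nat).
Variables (Z2 Z3 : {RV P >-> R}) (V6 : {RV P >-> nat}).
Hypotheses (mG : measurable_fun setT G) (mN : measurable_fun setT N).
Variables (lambda a b alpha : R).
Hypotheses (lambda0 : (0 < lambda)%R) (a0 : (0 < a)%R) (b0 : (0 < b)%R)
  (alpha0 : (0 < alpha)%R).
Hypothesis Z2_law : cond_law P G Z2
  (fun g => same_law (gamma_prob a (lambda + (N g)%:R))).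
Hypothesis V6_law : cond_law P (fun w => (G w, Z2 w)) V6
  (fun gz => same_law (poisson (alpha * gz.2))).
Hypothesis Z3_law : cond_law P (fun w => (G w, Z2 w, V6 w)) Z3
  (fun gzv => same_law (gamma_prob b (lambda + (N gzv.1.1 + gzv.2)%:R))).

Let mZ2 : measurable_fun setT Z2. Proof. exact: measurable_funPT. Qed.
Let mZ3 : measurable_fun setT Z3. Proof. exact: measurable_funPT. Qed.
Let mV6 : measurable_fun setT V6. Proof. exact: measurable_funPT. Qed.

Let shape_gt0 n : (0 < lambda + n%:R)%R.
Proof. by rewrite ltr_wpDr. Qed.

(** The positive shape excludes an atom at 0. The Poisson parameter [alpha * Z2] is then almost
    surely positive, as [poisson_pgf] and [poisson_count] ask. *)
Lemma Z2_gt0 : {ae P, forall w, (0 < Z2 w)%R}.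
Proof.
have := cond_law_null mG mZ2 Z2_law (measurable_itv `]-oo, 0%R])
  (fun x mu => @gamma_pos _ mu a _ (shape_gt0 (N x))).
by move=> H; apply: filterS H => w /negP; rewrite in_itv/= -ltNge.
Qed.

(** [J], [K] and [c] arise by integrating out [Z3], [V6] and [Z2] in this order. The weight [h]
    carries the conditioning on [G], and [J] receives [n + v] because the shape of [Z3] depends only
    on this sum. *)
Lemma pair_law_chain (F : R * R -> \bar R) (J K : R * nat -> \bar R)
    (c : nat -> \bar R) (h : TG -> \bar R) :
  mge0 F -> mge0 J -> mge0 K -> mge0 c -> mge0 h ->
  (forall z2 m (mu : {measure set R -> \bar R}), mu setT = 1 ->
    same_law (gamma_prob b (lambda + m%:R)) mu ->
    \int[mu]_y F (z2, y) = J (z2, m)) ->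
  (forall z2 n (mu : {measure set nat -> \bar R}), (0 < z2)%R -> mu setT = 1 ->
    same_law (poisson (alpha * z2)) mu ->
    \int[mu]_v J (z2, (n + v)%N) = K (z2, n)) ->
  (forall n (mu : {measure set R -> \bar R}), mu setT = 1 ->
    same_law (gamma_prob a (lambda + n%:R)) mu ->
    \int[mu]_z K (z, n) = c n) ->
  \int[P]_w (h (G w) * F (Z2 w, Z3 w)) = \int[P]_w (h (G w) * c (N (G w))).
Proof.
move=> hF hJ hK hc hh FJ JK Kc.
have mNadd : measurable_fun setT (fun gzv : TG * R * nat => (N gzv.1.1 + gzv.2)%N).
  apply: measurable_fun_prod_nat => v /=.
  apply: (@measurableT_comp _ _ _ _ _ _ (fun n => (n + v)%N)) => //.
  exact: measurableT_comp.
have mGZ : measurable_fun setT (fun w => (G w, Z2 w)) by exact: measurable_fun_pair.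
have mGZV : measurable_fun setT (fun w => (G w, Z2 w, V6 w)).
  exact: measurable_fun_pair.
pose f1 (x : TG * R * nat * R) := h x.1.1.1 * F (x.1.1.2, x.2).
pose g1 (x : TG * R * nat) := h x.1.1 * J (x.1.2, (N x.1.1 + x.2)%N).
have hf1 : mge0 f1.
  apply: mge0M; first by apply: mge0_comp hh _; do 2 apply: measurableT_comp => //.
  apply: mge0_comp hF _; apply: measurable_fun_pair => //.
  by do 2 apply: measurableT_comp => //.
have hg1 : mge0 g1.
  apply: mge0M; first by apply: mge0_comp hh _; apply: measurableT_comp => //.
  apply: mge0_comp hJ _; apply: measurable_fun_pair => //.
  exact: measurableT_comp.
rewrite (cond_lawE (f := f1) (g := g1) mGZV mZ3 Z3_law hf1 hg1); last first.
  apply: aeW => w mu mu1 muE /=; rewrite /f1 /g1 /= ge0_integralZl//.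
  - by congr (_ * _); exact: FJ.
  - by case: (mge0_comp hF (measurable_pair1 (Z2 w))).
  - by move=> y _; case: hF.
  - by case: hh.
pose g2 (x : TG * R) := h x.1 * K (x.2, N x.1).
have hg2 : mge0 g2.
  apply: mge0M; first exact: (mge0_comp hh measurable_fst).
  apply: mge0_comp hK _; apply: measurable_fun_pair => //.
  exact: measurableT_comp.
rewrite (cond_lawE (f := g1) (g := g2) mGZ mV6 V6_law hg1 hg2); last first.
  apply: filterS Z2_gt0 => w z20 mu mu1 muE /=; rewrite /g1 /g2 /= ge0_integralZl//.
  - by congr (_ * _); exact: JK.
  - by move=> y _; case: hJ.
  - by case: hh.
have hg3 : mge0 (fun g => h g * c (N g)).
  by apply: mge0M => //; exact: mge0_comp hc _.
rewrite (cond_lawE (f := g2) mG mZ2 Z2_law hg2 hg3)//.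
apply: aeW => w mu mu1 muE /=; rewrite /g2 /= ge0_integralZl//.
- by congr (_ * _); exact: Kc.
- by case: (mge0_comp hK (measurable_pair2 (N (G w)))).
- by move=> y _; case: hK.
- by case: hh.
Qed.

Local Notation leb := (@lebesgue_measure R).

Lemma integral_gamma_density (f : R -> \bar R) (mu : {measure set R -> \bar R}) e s :
  mge0 f -> (0 < s)%R -> same_law (gamma_prob e s) mu ->
  \int[mu]_x f x = \int[leb]_x (f x * (gamma_pdf e s x)%:E).
Proof.
move=> hf s0 muE.
apply: (integral_density (j := id : measurableTypeR R -> R) _ (mge0_gamma_pdf e s) hf).
  exact: measurable_id.
by move=> B mB; rewrite muE// /gamma_prob s0.
Qed.

(** For each fixed integer, measurability in the other variable is that of a Fubini-Tonelli partial
    integral. *)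
Lemma mge0_integral_gamma d0 (T0 : measurableType d0) (F : T0 * R -> \bar R) e
    (s : nat -> R) : mge0 F ->
  mge0 (fun zm : T0 * nat => \int[leb]_y (F (zm.1, y) * (gamma_pdf e (s zm.2) y)%:E)).
Proof.
move=> [mF F0].
have p0 s' y : 0 <= (gamma_pdf e s' y)%:E by rewrite lee_fin gamma_pdf_ge0.
split => [|z]; last by apply: integral_ge0 => y _; exact: mule_ge0.
apply: measurable_fun_prod_nat => m /=.
apply: (@measurable_fun_fubini_tonelli_F _ _ T0 (measurableTypeR R) R leb
  (fun zy : T0 * measurableTypeR R => F (zy.1, zy.2) * (gamma_pdf e (s m) zy.2)%:E)).
  apply: emeasurable_funM; first by under eq_fun do rewrite -surjective_pairing.
  apply/measurable_EFinP; apply: (measurableT_comp (measurable_gamma_pdf e (s m))).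
  exact: measurable_snd.
by move=> z; exact: mule_ge0.
Qed.

(** The intermediate functions are explicit integrals against the gamma and Poisson densities, so
    [c] exists for every [F], in particular for indicators. *)
Lemma pair_law_exists (F : R * R -> \bar R) : mge0 F ->
  exists2 c : nat -> \bar R, mge0 c & forall h, mge0 h ->
    \int[P]_w (h (G w) * F (Z2 w, Z3 w)) = \int[P]_w (h (G w) * c (N (G w))).
Proof.
move=> hF.
pose J zm := \int[leb]_y (F (zm.1, y) * (gamma_pdf b (lambda + zm.2%:R) y)%:E).
have hJ : mge0 J by exact: (mge0_integral_gamma b (fun n => lambda + n%:R)%R hF).
pose K (zn : R * nat) := \int[counting]_v
  (J (zn.1, (zn.2 + v)%N) * (poisson_pmf (alpha * zn.1) v)%:E).
have p0 m v : 0 <= (poisson_pmf m v)%:E :> \bar R by rewrite lee_fin poisson_pmf_ge0.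
have J0 z v : 0 <= J (z.1, (z.2 + v)%N) * (poisson_pmf (alpha * z.1) v)%:E.
  by apply: mule_ge0 => //; exact: hJ.2.
have hK : mge0 K.
  split => [|z]; last by apply: integral_ge0 => v _; exact: J0.
  apply: measurable_fun_prod_nat => n.
  have -> : (fun z => K (z, n)) =
      (fun z => \sum_(v <oo) (J (z, (n + v)%N) * (poisson_pmf (alpha * z) v)%:E)).
    by apply/funext => z; rewrite /K ge0_integral_count// => v; exact: (J0 (z, n)).
  apply: ge0_emeasurable_sum => [v z _ _|v _]; first exact: (J0 (z, n)).
  apply: emeasurable_funM; first by case: (mge0_comp hJ (measurable_pair2 (n + v)%N)).
  apply/measurable_EFinP; apply: (@measurableT_comp _ _ _ _ _ _ (@poisson_pmf R ^~ v)).
    exact: measurable_poisson_pmf.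
  exact: measurable_funM.
pose c n := \int[leb]_z (K (z, n) * (gamma_pdf a (lambda + n%:R) z)%:E).
have hc : mge0 c.
  split => // n; apply: integral_ge0 => z _; rewrite mule_ge0 ?lee_fin ?gamma_pdf_ge0//.
  by case: hK.
exists c => // h hh; apply: (pair_law_chain hF hJ hK hc hh).
- move=> z2 m mu _ muE.
  exact: (integral_gamma_density (mge0_comp hF (measurable_pair1 z2)) (shape_gt0 m) muE).
- move=> z2 n mu z20 _ muE.
  have hJ2 : mge0 (fun v => J (z2, (n + v)%N)) by split => // v; exact: hJ.2.
  have hp : mge0 (EFin \o poisson_pmf (alpha * z2)).
    by apply: mge0_EFin => // v; exact: poisson_pmf_ge0.
  rewrite (@integral_density _ _ _ _ _ counting mu id _ _ _ hp hJ2)// => B mB.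
  by rewrite muE// poisson_count// mulr_gt0.
- move=> n mu _ muE.
  exact: (integral_gamma_density (mge0_comp hK (measurable_pair2 n)) (shape_gt0 n) muE).
Qed.

(** The gamma transform of [Z3] contains [r ^+ V6], whose Poisson mixture is an exponential in [Z2].
    This moves [t2] to [t2 + alpha * (1 - r)], where the gamma transform of [Z2] is taken. *)
Lemma pair_laplace (t2 t3 : R) (h : TG -> \bar R) : (0 <= t2)%R -> (0 <= t3)%R ->
  mge0 h ->
  \int[P]_w (h (G w) * (expR (- (t2 * Z2 w + t3 * Z3 w)))%:E) =
  \int[P]_w (h (G w) * (((1 + b * t3) *
    (1 + a * (t2 + alpha * (1 - (1 + b * t3)^-1))))
      `^ (- (lambda + (N (G w))%:R)))%:E).
Proof.
move=> t20 t30 hh.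
have mE (t : R) : measurable_fun setT (fun x : R => expR (- (t * x))).
  by apply: measurableT_comp => //; apply: measurable_funN; exact: measurable_funM.
have c1 : (1 <= 1 + b * t3)%R by rewrite lerDl mulr_ge0// ltW.
have c0 : (0 < 1 + b * t3)%R by apply: lt_le_trans c1.
set r := ((1 + b * t3)^-1)%R.
have r0 : (0 < r)%R by rewrite invr_gt0.
have r1 : (r <= 1)%R by rewrite invf_le1.
have tr0 : (0 <= t2 + alpha * (1 - r))%R by rewrite addr_ge0// mulr_ge0 ?subr_ge0// ltW.
(* Separating the real exponent from the integer one makes the Poisson count an exponent of [r]. *)
have powE n :
    ((1 + b * t3) `^ (- (lambda + n%:R)) = (1 + b * t3) `^ (- lambda) * r ^+ n)%R.
  by rewrite opprD powRD ?(gt_eqF c0) ?implybT// powR_invn ?ltW// /r exprVn.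
pose F (z : R * R) := (expR (- (t2 * z.1)) * expR (- (t3 * z.2)))%:E.
pose J (z : R * nat) := (expR (- (t2 * z.1)) *
  ((1 + b * t3) `^ (- lambda) * r ^+ z.2))%:E.
pose K (z : R * nat) := ((1 + b * t3) `^ (- lambda) * r ^+ z.2 *
  expR (- ((t2 + alpha * (1 - r)) * z.1)))%:E.
have mr : measurable_fun setT (fun z : R * nat => r ^+ z.2 : R)%R.
  by apply: (@measurableT_comp _ _ _ _ _ _ (fun n => r ^+ n : R)%R).
transitivity (\int[P]_w (h (G w) * F (Z2 w, Z3 w))).
  by apply: eq_integral => w _; rewrite /F opprD expRD.
pose c n := (((1 + b * t3) * (1 + a * (t2 + alpha * (1 - r))))
  `^ (- (lambda + n%:R)))%:E.
apply: (pair_law_chain (F := F) (J := J) (K := K) (c := c)) => //.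
- apply: mge0_EFin; last by move=> z; rewrite mulr_ge0 ?expR_ge0.
  apply: measurable_funM; first exact: (measurableT_comp (mE t2)).
  exact: (measurableT_comp (mE t3)).
- apply: mge0_EFin; last first.
    by move=> z; rewrite !mulr_ge0 ?expR_ge0 ?powR_ge0// exprn_ge0// ltW.
  apply: measurable_funM; first exact: (measurableT_comp (mE t2)).
  exact: measurable_funM.
- apply: mge0_EFin; last first.
    by move=> z; rewrite !mulr_ge0 ?expR_ge0 ?powR_ge0// exprn_ge0// ltW.
  apply: measurable_funM; first exact: measurable_funM.
  exact: (measurableT_comp (mE _)).
- by apply: mge0_EFin => // n; exact: powR_ge0.
- move=> z2 m mu mu1 muE; rewrite /F /J /=; under eq_integral do rewrite EFinM.
  rewrite ge0_integralZl// ?lee_fin ?expR_ge0//; last first.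
    by apply/measurable_EFinP; exact: mE.
  by rewrite (gamma_laplace b0 _ t30 mu1 muE) ?ltW// powE.
- move=> z2 n mu z20 mu1 muE; rewrite /J /K /=.
  under eq_integral do rewrite exprD mulrA mulrA EFinM.
  rewrite ge0_integralZl//; last 2 first.
  - by move=> v _; rewrite lee_fin exprn_ge0// ltW.
  - by rewrite lee_fin !mulr_ge0 ?expR_ge0 ?powR_ge0// exprn_ge0// ltW.
  rewrite (poisson_pgf _ r0 muE) ?mulr_gt0// -EFinM; congr EFin.
  have -> : (- ((t2 + alpha * (1 - r)) * z2) =
      - (t2 * z2) + - (alpha * z2 * (1 - r)))%R by ring.
  by rewrite expRD; ring.
- move=> n mu mu1 muE; rewrite /K /=; under eq_integral do rewrite EFinM.
  rewrite ge0_integralZl//; last 2 first.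
  - by case: (mge0_EFin (mE (t2 + alpha * (1 - r))%R) (fun=> expR_ge0 _)).
  - by rewrite lee_fin mulr_ge0 ?powR_ge0// exprn_ge0// ltW.
  rewrite (gamma_laplace a0 _ tr0 mu1 muE) ?ltW// -EFinM -powE -powRM ?ltW//.
  by rewrite ltr_wpDr// mulr_ge0// ltW.
Qed.

Let Z23 w := [tuple Z2 w; Z3 w].

Lemma measurable_Z23 : measurable_fun setT Z23.
Proof.
apply/measurable_fun_tnthP => i; have [->|->] : i = ord0 \/ i = lift ord0 ord0.
- by case: i => [[|[|//]] ?]; [left|right]; apply/val_inj.
- by apply: eq_measurable_fun mZ2.
- by apply: eq_measurable_fun mZ3.
Qed.

Lemma cexp_nat_pair (F : 2.-tuple R -> \bar R) (c : nat -> \bar R) :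
  (forall h, mge0 h -> \int[P]_w (h (G w) * F (Z23 w)) =
    \int[P]_w (h (G w) * c (N (G w)))) ->
  cexp_nat P G Z23 N F c.
Proof. by move=> Fc A mA; rewrite !integral_preimage; exact: (Fc _ (mge0_indic mA)). Qed.

Definition pair_transform t2 t3 n : \bar R := (((1 + b * t3) *
    (1 + a * (t2 + alpha * (1 - (1 + b * t3)^-1)))) `^ (- (lambda + n%:R)))%:E.

Lemma cexp_nat_exp t2 t3 : (0 <= t2)%R -> (0 <= t3)%R ->
  cexp_nat P G Z23 N
    (fun y => (expR (- (t2 * tnth y ord0 + t3 * tnth y (lift ord0 ord0))))%:E)
    (pair_transform t2 t3).
Proof.
move=> t20 t30; apply: cexp_nat_pair => h hh; rewrite -(pair_laplace t20 t30 hh).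
by apply: eq_integral => w _; rewrite !(tnth_nth (0 : R)%R).
Qed.

(** The truncated exponentials are [unit_valued], as the product formula asks, and agree with the
    plain ones because [Z2] and [Z3] are almost surely nonnegative. *)
Lemma cexp_nat_exp_max t2 t3 : (0 <= t2)%R -> (0 <= t3)%R ->
  cexp_nat P G Z23 N
    (fun y => (exp_max t2 (tnth y ord0) * exp_max t3 (tnth y (lift ord0 ord0)))%:E)
    (pair_transform t2 t3).
Proof.
move=> t20 t30 A mA; rewrite -(cexp_nat_exp t20 t30 mA).
have mt i : measurable_fun setT (fun y : 2.-tuple R => tnth y i).
  exact: measurable_tnth.
have mA' : measurable (G @^-1` A) by exact: (preimage_measurable mG).
have mS (f : 2.-tuple R -> \bar R) : measurable_fun setT f ->
    measurable_fun (G @^-1` A) (fun w => f (Z23 w)).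
  by move=> mf; apply: measurable_funTS; exact: measurableT_comp measurable_Z23.
have mF1 : measurable_fun setT (fun y : 2.-tuple R =>
    (expR (- (t2 * tnth y ord0 + t3 * tnth y (lift ord0 ord0))))%:E).
  apply/measurable_EFinP; apply: measurableT_comp => //; apply: measurable_funN.
  by apply: measurable_funD; exact: measurable_funM.
have mF2 : measurable_fun setT (fun y : 2.-tuple R =>
    (exp_max t2 (tnth y ord0) * exp_max t3 (tnth y (lift ord0 ord0)))%:E).
  apply/measurable_EFinP; apply: measurable_funM; apply: measurableT_comp => //.
  - by case: (unit_valued_exp_max t20).
  - by case: (unit_valued_exp_max t30).
apply: ae_eq_integral => //; [exact: mS mF2|exact: mS mF1|].
have mGZV : measurable_fun setT (fun w => (G w, Z2 w, V6 w)).
  by do 2 apply: measurable_fun_pair => //.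
have Z3_ge0 := gamma_cond_ge0 mGZV mZ3 Z3_law.
have Z2_ge0 := gamma_cond_ge0 mG mZ2 Z2_law.
apply: filterS2 Z2_ge0 Z3_ge0 => w z2 z3 _.
by rewrite !(tnth_nth (0 : R)%R)/= !exp_maxE// opprD expRD.
Qed.

Lemma pair_cond_law : exists k : R.-pker TG ~> 2.-tuple R,
  regular_cond_dist P G Z23 k /\
  {ae P, forall w, forall F c, mge0 F -> cexp_nat P G Z23 N F c ->
    \int[k (G w)]_y F y = c (N (G w))}.
Proof.
apply: cond_law_nat => //; first exact: measurable_Z23.
move=> B mB.
have hF : mge0 (fun z : R * R => (\1_B [tuple z.1; z.2])%:E : \bar R).
  have mt : measurable_fun setT (fun z : R * R => [tuple z.1; z.2]).
    apply/measurable_fun_tnthP => i; have [->|->] : i = ord0 \/ i = lift ord0 ord0.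
    - by case: i => [[|[|//]] ?]; [left|right]; apply/val_inj.
    - exact: (eq_measurable_fun fst).
    - exact: (eq_measurable_fun snd).
  exact: (mge0_comp (mge0_indic mB) mt).
have [c hc Fc] := pair_law_exists hF.
by exists c; apply: cexp_nat_pair.
Qed.

End pair_kernel.

(** * Multi-affine polynomials and the positive orthant *)

Section multi_affine.
Context {R : realType} {n : nat}.

Lemma multi_affineD (Q1 Q2 : 'rV[R]_n -> R) : multi_affine Q1 -> multi_affine Q2 ->
  multi_affine (fun theta => Q1 theta + Q2 theta).
Proof.
move=> [c1 c1E] [c2 c2E]; exists (fun A => c1 A + c2 A) => theta.
by rewrite c1E c2E -big_split; apply: eq_bigr => A _; rewrite mulrDl.
Qed.

(** The coefficients are supported on one set, that of the indices in [s]; since [s] has no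
    repetition, the product over [s] is the product over this set. *)
Lemma multi_affine_monomial (c : R) (s : seq 'I_n) : uniq s ->
  multi_affine (fun theta => c * \prod_(i <- s) theta 0 i).
Proof.
move=> us; exists (fun A => if A == [set i in s]%SET then c else 0) => theta.
rewrite (bigD1 [set i in s]%SET)//= eqxx [X in _ + X]big1 => [|A AE]; last first.
  by rewrite (negbTE AE) mul0r.
rewrite addr0.
congr (_ * _); rewrite big_uniq//; apply: eq_bigl => i; by rewrite inE.
Qed.

Lemma interior_positive_orthant :
  interior [set theta : 'rV[R]_n | forall i, 0 < theta 0 i] !=set0.
Proof.
(* The unit ball about the all-ones vector lies in the orthant. *)
exists (const_mx 1); apply/nbhs_ballP; exists 1 => //= y /= [_ ball_y] i.
have := ball_y 0 i; rewrite mxE /ball/= => /(le_lt_trans (ler_norm _)).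
by rewrite ltrBlDr ltrDl.
Qed.

End multi_affine.

Section sigma_of.
Context {d d'} {T : measurableType d} {TY : measurableType d'}.
Variable Y : T -> TY.

Lemma sigma_of_setT : sigma_of Y setT.
Proof. by exists setT; rewrite // preimage_setT setTI. Qed.

Lemma sigma_of_preimage B : measurable B -> sigma_of Y (Y @^-1` B).
Proof. by move=> mB; exists B; rewrite // setTI. Qed.

End sigma_of.

(** * Products under conditional independence and Poisson mixing *)

Section cond_indep_integral.
Local Open Scope ereal_scope.
Context {R : realType} {d dX : measure_display} {T : measurableType d}
  {TX : measurableType dX}.
Variables (P : probability T R) (X : T -> TX) (mX : measurable_fun setT X).

Lemma cond_indep_integral n (F : n.-tuple (set_system T)) (u : 'I_n -> T -> R)
    (h : 'I_n -> TX -> R) (f : TX -> \bar R) : cond_indep P X F ->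
  (forall i, tnth F i setT) -> (forall i, cond_version P X (tnth F i) (u i) (h i)) ->
  mge0 f ->
  \int[P]_w (f (X w) * (\prod_(i < n) u i w)%:E) =
  \int[P]_w (f (X w) * (\prod_(i < n) h i (X w))%:E).
Proof.
move=> FI FT Fuh hf.
apply: (@cexp_integral _ _ _ _ _ P X mX (fun w => \prod_(i < n) u i w)%R
  (fun x => \prod_(i < n) h i x)%R) => //.
- by apply: unit_valued_mge0; apply: unit_valued_prod => i; case: (Fuh i).
- by apply: unit_valued_mge0; apply: unit_valued_prod => i; case: (Fuh i).
- exact: cond_indep_prod FI FT Fuh.
Qed.

End cond_indep_integral.

(** Given [X], conditional independence gives the product of the Poisson generating functions, whose
    exponents add up. *)
Lemma poisson_thinning {R : realType} {d} {T : measurableType d}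
    (P : probability T R) (X : T -> R) n (V : 'I_n -> T -> nat)
    (F : n.-tuple (set_system T)) (alpha rho : 'I_n -> R) (f : R -> \bar R) :
  measurable_fun setT X -> (forall i, measurable_fun setT (V i)) ->
  {ae P, forall w, 0 < X w} -> (forall i, 0 < alpha i) ->
  (forall i, 0 < rho i <= 1) ->
  (forall i, tnth F i = sigma_of (V i)) ->
  (forall i, cond_law P X (V i) (fun x => same_law (poisson (alpha i * x)))) ->
  cond_indep P X F -> mge0 f ->
  (\int[P]_w (f (X w) * (\prod_(i < n) rho i ^+ V i w)%:E) =
   \int[P]_w (f (X w) *
     (expR (- ((\sum_(i < n) alpha i * (1 - rho i)) * X w)))%:E))%E.
Proof.
move=> mX mV X0 alpha0 rho01 FV HV FI hf.
have /choice[k hk] : forall i, exists k : R.-pker _ ~> _,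
    regular_cond_dist P X (V i) k /\
    {ae P, forall w, same_law (poisson (alpha i * X w)) (k (X w))} by exact: HV.
have uV i : unit_valued (fun v : nat => rho i ^+ v).
  split => // v; have /andP[r0 r1] := rho01 i.
  by rewrite (exprn_ge0 _ (ltW r0)) (exprn_ile1 _ (ltW r0) r1).
have cV i : cond_version P X (tnth F i) (fun w => rho i ^+ V i w)
    (kexp (k i) (fun v => rho i ^+ v)).
  apply: (@cond_version_kexp _ _ _ _ _ P X mX _ _ (V i) _ _
    (fun v => rho i ^+ v)) => //.
    by case: (hk i).
  by rewrite FV => B mB; exact: sigma_of_preimage.
rewrite (cond_indep_integral mX FI _ cV hf); last first.
  by move=> i; rewrite FV; exact: sigma_of_setT.
pose h i := kexp (k i) (fun v => rho i ^+ v).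
have uh i : unit_valued (h i) by exact: unit_valued_kexp.
have mfX : measurable_fun setT (f \o X) by apply: measurableT_comp => //; case: hf.
apply: ge0_ae_eq_integral => //.
- apply: emeasurable_funM => //; apply/measurable_EFinP.
  apply: (@measurableT_comp _ _ _ _ _ _ (fun x => \prod_(i < n) h i x)) => //.
  by case: (unit_valued_prod (index_enum 'I_n) xpredT uh).
- apply: emeasurable_funM => //; apply/measurable_EFinP.
  by apply: measurableT_comp => //; apply: measurable_funN; exact: measurable_funM.
- move=> w _; apply: mule_ge0; first by case: hf.
  by rewrite lee_fin prodr_ge0// => i _; case: (uh i) => _ /(_ (X w))/andP[].
- by move=> w _; apply: mule_ge0; [case: hf|rewrite lee_fin expR_ge0].
(* The almost sure events of the finitely many indices are intersected by induction on the index
   sequence. *)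
have aeV : {ae P, forall w, forall i, same_law (poisson (alpha i * X w)) (k i (X w))}.
  have : \forall w \ae P, forall i, i \in index_enum 'I_n ->
      same_law (poisson (alpha i * X w)) (k i (X w)).
    elim: (index_enum 'I_n) => [|i s IH]; first exact: aeW.
    apply: filterS2 IH (hk i).2 => w hs hi j; rewrite inE => /predU1P[->//|]; exact: hs.
  by apply: filterS => w hw i; apply: hw; rewrite mem_index_enum.
apply: filterS2 X0 aeV => w Xw0 kw _; congr (_ * _%:E)%E.
rewrite mulr_suml -sumrN expR_sum; apply: eq_bigr => i _.
have /andP[r0 r1] := rho01 i.
apply: EFin_inj; rewrite kexpK// (poisson_pgf _ r0 (kw i)) ?mulr_gt0//.
by congr (expR (- _))%:E; ring.
Qed.

Lemma forall_ord3 (Q : 'I_3 -> Prop) : Q 0 -> Q 1 -> Q 2 -> forall i, Q i.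
Proof.
move=> Q0 Q1 Q2 [[|[|[|//]]] i3]; [move: Q0|move: Q1|move: Q2];
by congr Q; apply/val_inj.
Qed.

Lemma forall_ord5 (Q : 'I_5 -> Prop) : Q 0 -> Q 1 -> Q 2 -> Q 3 -> Q 4 -> forall i, Q i.
Proof.
move=> Q0 Q1 Q2 Q3 Q4 [[|[|[|[|[|//]]]]] i5];
  [move: Q0|move: Q1|move: Q2|move: Q3|move: Q4]; by congr Q; apply/val_inj.
Qed.

Lemma eq_cond_law {R : realType} {d dX dY} {T : measurableType d}
    {TX : measurableType dX} {TY : measurableType dY} (P : probability T R)
    (X : T -> TX) (Y : T -> TY) (L L' : TX -> (set TY -> \bar R) -> Prop) :
  L =1 L' -> cond_law P X Y L -> cond_law P X Y L'.
Proof. by move=> /funext ->. Qed.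

Lemma measurable_tuple3 {R : realType} {d} {T : measurableType d} (f g h : T -> R) :
  measurable_fun setT f -> measurable_fun setT g -> measurable_fun setT h ->
  measurable_fun setT (fun w => [tuple f w; g w; h w]).
Proof.
move=> mf mg mh; apply/measurable_fun_tnthP => -[[|[|[|//]]] i3].
- exact: (eq_measurable_fun f).
- exact: (eq_measurable_fun g).
- exact: (eq_measurable_fun h).
Qed.

(** * Laplace transforms of the pair and of the triple *)

Theorem theorem36 (R : realType) (lambda p1 p2 p3 p12 p13 p23 p123 : R) :
  let P3 := fun theta : 'rV[R]_3 =>
    1 + p1 * theta 0 0 + p2 * theta 0 1 + p3 * theta 0 2
      + p12 * theta 0 0 * theta 0 1 + p13 * theta 0 0 * theta 0 2
      + p23 * theta 0 1 * theta 0 2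
      + p123 * theta 0 0 * theta 0 1 * theta 0 2 in
  let b12 := p13 * p23 / p123 ^+ 2 - p3 / p123 in
  let b13 := p12 * p23 / p123 ^+ 2 - p2 / p123 in
  let b23 := p13 * p12 / p123 ^+ 2 - p1 / p123 in
  let b123 := - (1 / p123) + p23 * p1 / p123 ^+ 2 + p13 * p2 / p123 ^+ 2
    + p12 * p3 / p123 ^+ 2 - 2 * p23 * p13 * p12 / p123 ^+ 3 in
  (* opp_q2, opp_q3, opp_q23 stand for the opposites of the coefficients
     written p-tilde with indices 2, 3 and {2,3} *)
  let opp_q2 := p13 / p123 in
  let opp_q3 := p12 / p123 in
  let opp_q23 := p1 / p123 in
  (* coordinates 0 and 1 of theta are theta_2 and theta_3 *)
  let S23 := fun theta : 'rV[R]_2 =>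
    1 + p12 / p1 * theta 0 0 + p13 / p1 * theta 0 1
      + p123 / p1 * theta 0 0 * theta 0 1 in
  let alpha1 := b12 / opp_q2 in
  let alpha2 := b13 / opp_q3 in
  let alpha3 := b123 / opp_q23 in
  let alpha4 := b12 * b23 / (opp_q2 * opp_q23) in
  let alpha5 := b13 * b23 / (opp_q3 * opp_q23) in
  let alpha6 := b23 / opp_q3 in
  0 < lambda ->
  0 < p1 -> 0 < p2 -> 0 < p3 -> 0 < p12 -> 0 < p13 -> 0 < p23 -> 0 < p123 ->
  0 < b12 -> 0 < b13 -> 0 < b23 -> 0 < b123 ->
  forall (d : measure_display) (T : measurableType d) (P : probability T R)
    (X1 Y2 Y3 Z2 Z3 : {RV P >-> R}) (V1 V2 V3 V4 V5 V6 : {RV P >-> nat}),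
  let G := fun w => (X1 w, V1 w, V2 w, V3 w, V4 w, V5 w) in
  same_law (gamma_prob p1 lambda) (distribution P X1) ->
  cond_law P X1 V1 (fun x => same_law (poisson (alpha1 * x))) ->
  cond_law P X1 V2 (fun x => same_law (poisson (alpha2 * x))) ->
  cond_law P X1 V3 (fun x => same_law (poisson (alpha3 * x))) ->
  cond_law P X1 V4 (fun x => same_law (poisson (alpha4 * x))) ->
  cond_law P X1 V5 (fun x => same_law (poisson (alpha5 * x))) ->
  cond_indep P X1 [tuple sigma_of V1; sigma_of V2; sigma_of V3; sigma_of V4;
                         sigma_of V5] ->
  cond_law P G Z2 (fun '(x, v1, v2, v3, v4, v5) =>
    same_law (gamma_prob (p12 / p1) (lambda + v3%:R + v4%:R + v5%:R))) ->
  cond_law P G Y2 (fun '(x, v1, v2, v3, v4, v5) =>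
    same_law (gamma_prob opp_q2^-1 (v1%:R + v4%:R))) ->
  cond_law P G Y3 (fun '(x, v1, v2, v3, v4, v5) =>
    same_law (gamma_prob opp_q3^-1 (v2%:R + v5%:R))) ->
  cond_law P (fun w => (G w, Z2 w)) V6 (fun '(_, z2) =>
    same_law (poisson (alpha6 * z2))) ->
  cond_law P (fun w => (G w, Z2 w, V6 w)) Z3
    (fun '(x, v1, v2, v3, v4, v5, z2, v6) =>
      same_law (gamma_prob opp_q3^-1
        (lambda + v3%:R + v4%:R + v5%:R + v6%:R))) ->
  cond_indep P G [tuple sigma_of Y2; sigma_of Y3;
                        sigma_of (fun w => (Z2 w, V6 w, Z3 w))] ->
  cond_law P G (fun w => [tuple Z2 w; Z3 w])
    (fun '(x, v1, v2, v3, v4, v5) =>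
      mgamma S23 (lambda + v3%:R + v4%:R + v5%:R)) /\
  let X2 := fun w => Y2 w + Z2 w in
  let X3 := fun w => Y3 w + Z3 w in
  mgamma P3 lambda (pushforward P (fun w => [tuple X1 w; X2 w; X3 w])).
Proof.
move=> P3 b12 b13 b23 b123 oq2 oq3 oq23 S23 al1 al2 al3 al4 al5 al6 l0 p10 p20 p30
  p120 p130 p230 p1230 b120 b130 b230 b1230 d T P X1 Y2 Y3 Z2 Z3 V1 V2 V3 V4 V5 V6 G
  HX1 HV1 HV2 HV3 HV4 HV5 IV HZ2 HY2 HY3 HV6 HZ3 IY.
have oq20 : 0 < oq2 by rewrite divr_gt0.
have oq30 : 0 < oq3 by rewrite divr_gt0.
have oq230 : 0 < oq23 by rewrite divr_gt0.
have a0 : 0 < p12 / p1 by rewrite divr_gt0.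
have ioq20 : 0 < oq2^-1 by rewrite invr_gt0.
have ioq30 : 0 < oq3^-1 by rewrite invr_gt0.
have al10 : 0 < al1 by rewrite divr_gt0.
have al20 : 0 < al2 by rewrite divr_gt0.
have al30 : 0 < al3 by rewrite divr_gt0.
have al40 : 0 < al4 by rewrite divr_gt0// mulr_gt0.
have al50 : 0 < al5 by rewrite divr_gt0// mulr_gt0.
have al60 : 0 < al6 by rewrite divr_gt0.
have [[p1g p2g] p3g] := (ltW p10, ltW p20, ltW p30).
have [[p12g p13g] p23g] := (ltW p120, ltW p130, ltW p230).
have p123g := ltW p1230.
have pn1 : p1 != 0 by rewrite gt_eqF.
have pn12 : p12 != 0 by rewrite gt_eqF.
have pn13 : p13 != 0 by rewrite gt_eqF.
have pn123 : p123 != 0 by rewrite gt_eqF.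
pose TG := (R * nat * nat * nat * nat * nat)%type.
(* The shapes of [Z2] and [Z3] involve [G] only through this count. *)
pose N (g : TG) := (g.1.1.2 + g.1.2 + g.2)%N.
have mX1 : measurable_fun setT X1 by exact: measurable_funPT.
have mY2 : measurable_fun setT Y2 by exact: measurable_funPT.
have mY3 : measurable_fun setT Y3 by exact: measurable_funPT.
have mG : measurable_fun setT G by do 5 (apply: measurable_fun_pair => //).
have m1 : measurable_fun setT (fun g : TG => g.1) by exact: measurable_fst.
have m11 : measurable_fun setT (fun g : TG => g.1.1) by exact: measurableT_comp m1.
have m111 : measurable_fun setT (fun g : TG => g.1.1.1) by exact: measurableT_comp m11.
have m1111 : measurable_fun setT (fun g : TG => g.1.1.1.1) by exact: measurableT_comp m111.
have m11111 : measurable_fun setT (fun g : TG => g.1.1.1.1.1) by exact: measurableT_comp m1111.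
have mN : measurable_fun setT N.
  apply: measurable_fun_prod_nat => n5.
  apply: (@measurableT_comp _ _ _ _ _ _ (fun n => (n + n5)%N)) => //=.
  apply: measurable_fun_prod_nat => n4 /=.
  apply: (@measurableT_comp _ _ _ _ _ _ (fun n => (n + n4)%N)) => //=.
have HZ2' : cond_law P G Z2
    (fun g : TG => same_law (gamma_prob (p12 / p1) (lambda + (N g)%:R))).
  by apply: eq_cond_law HZ2 => -[[[[[x v1] v2] v3] v4] v5]; rewrite /N/= !natrD !addrA.
have HV6' : cond_law P (fun w => (G w, Z2 w)) V6
    (fun gz : TG * R => same_law (poisson (al6 * gz.2))).
  by apply: eq_cond_law HV6 => -[g z2].
have HZ3' : cond_law P (fun w => (G w, Z2 w, V6 w)) Z3
    (fun gzv : TG * R * nat =>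
      same_law (gamma_prob oq3^-1 (lambda + (N gzv.1.1 + gzv.2)%:R))).
  by apply: eq_cond_law HZ3 => -[[[[[[[x v1] v2] v3] v4] v5] z2] v6];
    rewrite /N/= !natrD !addrA.
have HY2' : cond_law P G Y2
    (fun g : TG => same_law (gamma_prob oq2^-1 (g.1.1.1.1.2 + g.1.2)%:R)).
  by apply: eq_cond_law HY2 => -[[[[[x v1] v2] v3] v4] v5]; rewrite natrD.
have HY3' : cond_law P G Y3
    (fun g : TG => same_law (gamma_prob oq3^-1 (g.1.1.1.2 + g.2)%:R)).
  by apply: eq_cond_law HY3 => -[[[[[x v1] v2] v3] v4] v5]; rewrite natrD.
pose S t2 t3 := 1 + p12 / p1 * t2 + p13 / p1 * t3 + p123 / p1 * t2 * t3.
(* The coefficient of [t3] is [oq3^-1 * (1 + p12 / p1 * al6)], and the value of [al6] makes it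
   [p13 / p1]. *)
have SE t2 t3 : 0 <= t2 -> 0 <= t3 -> (1 + oq3^-1 * t3) *
    (1 + p12 / p1 * (t2 + al6 * (1 - (1 + oq3^-1 * t3)^-1))) = S t2 t3.
  move=> t20 t30; rewrite /S /al6 /b23 /oq3; field.
  by rewrite pn1 pn123 pn12/= gt_eqF// ltr_wpDr// mulr_ge0// ltW.
(* This kernel serves twice: as the witness for the first claim, and for the third factor when
   conditional independence is applied. *)
have [k [hk aek]] := pair_cond_law mG mN l0 al60 HZ2' HV6' HZ3'.
have Spos t2 t3 : 0 <= t2 -> 0 <= t3 -> 0 < S t2 t3.
  by move=> t20 t30; do 3 (apply: ltr_wpDr; first by rewrite !mulr_ge0 ?invr_ge0).
split.
  exists k; split => //; apply: filterS aek => w kw.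
  split.
  - have -> : S23 = (fun theta => 1 * \prod_(i <- [::]) theta 0 i
        + p12 / p1 * \prod_(i <- [:: 0]) theta 0 i
        + p13 / p1 * \prod_(i <- [:: 1]) theta 0 i
        + p123 / p1 * \prod_(i <- [:: 0; 1]) theta 0 i).
      by apply/funext => theta; rewrite /S23 !big_cons !big_nil; ring.
    by do 3 (apply: multi_affineD; last exact: multi_affine_monomial);
      exact: multi_affine_monomial.
  - by rewrite /S23 !mxE !mulr0 !addr0.
  - by do 3 (rewrite ltr_wpDr//).
  (* The domain is the same for every [w], since [kw] covers all transforms at once. *)
  exists [set theta | forall i, 0 < theta 0 i]; split; first exact: interior_positive_orthant.
  move=> theta theta0; split; first exact: Spos (ltW _) (ltW _).
  have t2 := ltW (theta0 0); have t3 := ltW (theta0 1).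
  have I1 : lift ord0 ord0 = 1 :> 'I_2 by apply/val_inj.
  have := kw _ _ _ (cexp_nat_exp mG mN l0 a0 ioq30 al60 HZ2' HV6' HZ3' t2 t3).
  rewrite /pair_transform SE// /N /= !natrD !addrA -/(S23 theta) => <-.
    by apply: eq_integral => y _; rewrite !big_ord_recl big_ord0 addr0 I1.
  apply: mge0_EFin; last by move=> y; exact: expR_ge0.
  apply: measurableT_comp => //; apply: measurable_funN.
  by apply: measurable_funD; apply: measurable_funM => //; exact: measurable_tnth.
move=> X2 X3; split.
- have -> : P3 = (fun theta => 1 * \prod_(i <- [::]) theta 0 i
      + p1 * \prod_(i <- [:: 0]) theta 0 i + p2 * \prod_(i <- [:: 1]) theta 0 i
      + p3 * \prod_(i <- [:: 2]) theta 0 i + p12 * \prod_(i <- [:: 0; 1]) theta 0 i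
      + p13 * \prod_(i <- [:: 0; 2]) theta 0 i
      + p23 * \prod_(i <- [:: 1; 2]) theta 0 i
      + p123 * \prod_(i <- [:: 0; 1; 2]) theta 0 i).
    by apply/funext => theta; rewrite /P3 !big_cons !big_nil; ring.
  by do 7 (apply: multi_affineD; last exact: multi_affine_monomial);
    exact: multi_affine_monomial.
- by rewrite /P3 !mxE !mulr0 !addr0.
- by [].
exists [set theta | forall i, 0 < theta 0 i]; split; first exact: interior_positive_orthant.
move=> theta theta0.
set t1 := theta 0 0; set t2 := theta 0 1; set t3 := theta 0 2.
have t10 : 0 < t1 by exact: theta0.
have t20 : 0 < t2 by exact: theta0.
have t30 : 0 < t3 by exact: theta0.
have P3pos : 0 < P3 theta.
  by do 7 (apply: ltr_wpDr; first by rewrite !mulr_ge0 ?ltW).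
split => //.
have mE d0 (T0 : measurableType d0) (t : R) (Y : T0 -> R) : measurable_fun setT Y ->
    measurable_fun setT (fun w => expR (- (t * Y w))).
  by move=> mY; apply: measurableT_comp => //; apply: measurable_funN; exact: measurable_funM.
have mZ2 : measurable_fun setT Z2 by exact: measurable_funPT.
have mZ3 : measurable_fun setT Z3 by exact: measurable_funPT.
have mX2 : measurable_fun setT X2 by exact: measurable_funD.
have mX3 : measurable_fun setT X3 by exact: measurable_funD.
transitivity (\int[P]_w (expR (- (t1 * X1 w)) *
    (expR (- (t2 * X2 w)) * expR (- (t3 * X3 w))))%:E)%E.
  rewrite (ge0_integral_pushforward (measurable_tuple3 mX1 mX2 mX3))//; last first.
    apply/measurable_EFinP; apply: measurableT_comp => //; apply: measurable_funN.
    apply: measurable_sum => i; apply: measurable_funM => //; exact: measurable_tnth.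
  rewrite preimage_setT; apply: eq_integral => w _.
  rewrite /comp !big_ord_recl big_ord0 addr0 -!expRD -!opprD /=.
  rewrite (_ : lift ord0 (lift ord0 ord0) = 2); last exact/val_inj.
  by rewrite (_ : lift ord0 ord0 = 1); last exact/val_inj.
have [k2 [hk2 aek2]] := HY2'.
have [k3 [hk3 aek3]] := HY3'.
have u2 := unit_valued_exp_max (ltW t20).
have u3 := unit_valued_exp_max (ltW t30).
pose F (y : 2.-tuple R) :=
  exp_max t2 (tnth y ord0) * exp_max t3 (tnth y (lift ord0 ord0)).
have uF : unit_valued F.
  by apply: unit_valuedM; [apply: unit_valued_comp u2|apply: unit_valued_comp u3];
    exact: measurable_tnth.
pose u := tnth [tuple (fun w => exp_max t2 (Y2 w)); (fun w => exp_max t3 (Y3 w));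
  (fun w => F [tuple Z2 w; Z3 w])].
pose h := tnth [tuple kexp k2 (exp_max t2); kexp k3 (exp_max t3); kexp k F].
pose FF := [tuple sigma_of Y2; sigma_of Y3; sigma_of (fun w => (Z2 w, V6 w, Z3 w))].
have FT i : tnth FF i setT by move: i; apply: forall_ord3; exact: sigma_of_setT.
have mtup : measurable_fun setT (fun t : R * nat * R => [tuple t.1.1; t.2]).
  apply/measurable_fun_tnthP => -[[|[|//]] i2].
  - by apply: (eq_measurable_fun (fun t : R * nat * R => t.1.1)) => //; exact: measurableT_comp.
  - exact: (eq_measurable_fun snd).
have mZ23 : measurable_fun setT (fun w => [tuple Z2 w; Z3 w]) by exact: measurable_Z23.
have Fuh i : cond_version P G (tnth FF i) (u i) (h i).
  move: i; apply: forall_ord3.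
  - exact: (cond_version_kexp mG mY2 hk2 (@sigma_of_preimage _ _ _ _ Y2) u2).
  - exact: (cond_version_kexp mG mY3 hk3 (@sigma_of_preimage _ _ _ _ Y3) u3).
  - apply: (cond_version_kexp mG mZ23 hk) => // B mB.
    (* Dropping [V6] shows that events of the pair belong to the sigma-algebra of the triple. *)
    exists ((fun t : R * nat * R => [tuple t.1.1; t.2]) @^-1` B); last by rewrite setTI.
    exact: (preimage_measurable mtup).
pose f (g : TG) : \bar R := (expR (- (t1 * g.1.1.1.1.1)))%:E.
have hf : mge0 f by apply: mge0_EFin; [exact: mE m11111|move=> g; exact: expR_ge0].
have mfG : measurable_fun setT (f \o G) by case: (mge0_comp hf mG).
have mX1E : measurable_fun setT (fun w => expR (- (t1 * X1 w))) by exact: mE.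
(* [Y2], [Y3], [Z2] and [Z3] are almost surely nonnegative, so truncation leaves the integral
   unchanged. *)
transitivity (\int[P]_w (f (G w) * (\prod_(i < 3) u i w)%:E))%E.
  have [mu mu0] : mge0 (EFin \o fun w => \prod_(i < 3) u i w).
    by apply: unit_valued_mge0; apply: unit_valued_prod => i; case: (Fuh i).
  apply: ge0_ae_eq_integral => //.
  - by apply/measurable_EFinP; do 2 (apply: measurable_funM; first exact: mE); exact: mE.
  - exact: emeasurable_funM.
  - by move=> w _; apply: mule_ge0; [exact: (hf.2 _)|exact: mu0].
  have mGZV : measurable_fun setT (fun w => (G w, Z2 w, V6 w)).
    by do 2 apply: measurable_fun_pair => //.
  have YY : {ae P, forall w, 0 <= Y2 w /\ 0 <= Y3 w}.
    by apply: filterS2 (gamma_cond_ge0 mG mY2 HY2') (gamma_cond_ge0 mG mY3 HY3').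
  have ZZ : {ae P, forall w, 0 <= Z2 w /\ 0 <= Z3 w}.
    by apply: filterS2 (gamma_cond_ge0 mG mZ2 HZ2') (gamma_cond_ge0 mGZV mZ3 HZ3').
  apply: filterS2 YY ZZ => w [/= y2 y3] [/= z2 z3] _.
  rewrite !big_ord_recl big_ord0 /u !(tnth_nth (fun=> 0))/= /F !(tnth_nth 0)/=.
  rewrite !exp_maxE// /f /G/= -EFinM; congr EFin.
  by rewrite /X2 /X3 !mulrDr !opprD !expRD; ring.
rewrite (cond_indep_integral mG IY FT Fuh hf).
pose r2 := (1 + oq2^-1 * t2)^-1; pose r3 := (1 + oq3^-1 * t3)^-1; pose rS := (S t2 t3)^-1.
(* [V4] enters the shapes of both [Y2] and the pair, hence the product [r2 * rS]; likewise [V5]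
   enters those of [Y3] and the pair. *)
pose rho := tnth [tuple r2; r3; rS; r2 * rS; r3 * rS].
pose V := tnth [tuple (V1 : T -> nat); (V2 : T -> nat); (V3 : T -> nat);
  (V4 : T -> nat); (V5 : T -> nat)].
pose al := tnth [tuple al1; al2; al3 : R; al4; al5].
pose fX (x : R) : \bar R := (S t2 t3 `^ (- lambda) * expR (- (t1 * x)))%:E.
have rho01 i : 0 < rho i <= 1.
  have inv01 (x : R) : 0 <= x -> 0 < (1 + x)^-1 <= 1.
    by move=> x0; rewrite invr_gt0 ltr_wpDr//= invf_le1 ?ltr_wpDr// lerDl.
  have r201 : 0 < r2 <= 1 by apply: inv01; rewrite mulr_ge0 ?ltW.
  have r301 : 0 < r3 <= 1 by apply: inv01; rewrite mulr_ge0 ?ltW.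
  have rS01 : 0 < rS <= 1.
    rewrite /rS /S -!addrA; apply: inv01.
    by rewrite !addr_ge0// !mulr_ge0 ?invr_ge0 ?ltW.
  have mul01 (x y : R) : 0 < x <= 1 -> 0 < y <= 1 -> 0 < x * y <= 1.
    move=> /andP[x0 x1] /andP[y0 y1]; rewrite mulr_gt0//=.
    by rewrite mulr_ile1// ltW.
  by move: i; apply: forall_ord5; rewrite /rho (tnth_nth 0)//=; exact: mul01.
have mV i : measurable_fun setT (V i).
  by move: i; apply: forall_ord5; rewrite /V (tnth_nth (fun _ : T => 0%N))/=.
have uV i : unit_valued (fun w => rho i ^+ V i w).
  have /andP[ri0 ri1] := rho01 i; split.
    exact: (@measurableT_comp _ _ _ _ _ _ (fun n => rho i ^+ n)).
  by move=> w; rewrite (exprn_ge0 _ (ltW ri0)) (exprn_ile1 _ (ltW ri0) ri1).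
have hfX : mge0 fX.
  apply: mge0_EFin; last by move=> x; rewrite mulr_ge0 ?expR_ge0 ?powR_ge0.
  by apply: measurable_funM => //; exact: mE.
have Sp : 0 < S t2 t3 by apply: Spos; exact: ltW.
(* The three conditional transforms are powers of [r2], [r3] and [S t2 t3] with exponents linear in
   the counts; they are regrouped by count. *)
transitivity (\int[P]_w (fX (X1 w) * (\prod_(i < 5) rho i ^+ V i w)%:E))%E.
  have [mh mh0] : mge0 (EFin \o (fun g => \prod_(i < 3) h i g)).
    by apply: unit_valued_mge0; apply: unit_valued_prod => i; case: (Fuh i).
  have [mv mv0] := unit_valued_mge0 (unit_valued_prod (index_enum 'I_5) xpredT uV).
  apply: ge0_ae_eq_integral => //.
  - apply: emeasurable_funM => //.
    exact: (@measurableT_comp _ _ _ _ _ _ (EFin \o (fun g => \prod_(i < 3) h i g)) _ G).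
  - by apply: emeasurable_funM => //; case: (mge0_comp hfX mX1).
  - by move=> w _; apply: mule_ge0; [exact: (hf.2 _)|exact: mh0].
  - by move=> w _; apply: mule_ge0; [exact: (hfX.2 _)|exact: mv0].
  apply: filterS3 aek2 aek3 aek => w k2w k3w kw _.
  have h2 : kexp k2 (exp_max t2) (G w) = r2 ^+ (V1 w + V4 w).
    apply: EFin_inj; rewrite kexpK//.
    rewrite (gamma_laplace_max ioq20 (ler0n _ _) (ltW t20) (prob_kernel _) k2w).
    by rewrite powR_invn ?exprVn// addr_ge0// mulr_ge0// ltW.
  have h3 : kexp k3 (exp_max t3) (G w) = r3 ^+ (V2 w + V5 w).
    apply: EFin_inj; rewrite kexpK//.
    rewrite (gamma_laplace_max ioq30 (ler0n _ _) (ltW t30) (prob_kernel _) k3w).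
    by rewrite powR_invn ?exprVn// addr_ge0// mulr_ge0// ltW.
  have hS : kexp k F (G w) = S t2 t3 `^ (- lambda) * rS ^+ (V3 w + V4 w + V5 w).
    apply: EFin_inj; rewrite kexpK//.
    rewrite (kw _ _ (unit_valued_mge0 uF) (cexp_nat_exp_max mG mN l0 a0 ioq30 al60
      HZ2' HV6' HZ3' (ltW t20) (ltW t30))) /pair_transform SE ?ltW//.
    by rewrite opprD powRD ?(gt_eqF Sp) ?implybT// powR_invn ?ltW// /rS exprVn.
  rewrite !big_ord_recl !big_ord0 /h !(tnth_nth (fun=> 0))/= h2 h3 hS.
  rewrite /rho !(tnth_nth 0)/= /V !(tnth_nth (fun _ : T => 0%N))/= /f /fX /G/= -!EFinM.
  by congr EFin; rewrite !exprD !exprMn; ring.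
(* Positivity of [X1] makes the five Poisson parameters positive. *)
have X1pos : {ae P, forall w, 0 < X1 w}.
  exists (X1 @^-1` `]-oo, 0]); split.
  - exact: (preimage_measurable mX1).
  - exact: (gamma_pos l0 HX1).
  - by move=> w /= /negP; rewrite in_itv/= -leNgt.
have al0 i : 0 < al i by move: i; apply: forall_ord5; rewrite /al (tnth_nth 0).
have HV i : cond_law P X1 (V i) (fun x => same_law (poisson (al i * x))).
  move: i; apply: forall_ord5;
    [exact: HV1|exact: HV2|exact: HV3|exact: HV4|exact: HV5].
have FV i : tnth [tuple sigma_of V1; sigma_of V2; sigma_of V3; sigma_of V4;
    sigma_of V5] i = sigma_of (V i) by move: i; apply: forall_ord5.
rewrite (poisson_thinning mX1 mV X1pos al0 rho01 FV HV IV hfX).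
(* The five counts shift the argument of the transform of [X1] by [c], and [c0] keeps it in the
   range of [gamma_laplace]. *)
set c := \sum_(i < 5) al i * (1 - rho i).
have c0 : 0 <= c.
  apply: sumr_ge0 => i _; rewrite mulr_ge0 ?(ltW (al0 i))// subr_ge0.
  by case/andP: (rho01 i).
have tc0 : 0 <= t1 + c by rewrite addr_ge0// ltW.
transitivity ((S t2 t3 `^ (- lambda))%:E * \int[P]_w (expR (- ((t1 + c) * X1 w)))%:E)%E.
  transitivity (\int[P]_w ((S t2 t3 `^ (- lambda))%:E * (expR (- ((t1 + c) * X1 w)))%:E))%E.
    apply: eq_integral => w _; rewrite /fX -!EFinM; congr EFin.
    by rewrite mulrDl opprD expRD mulrA.
  have [mc mc0] := mge0_EFin (mE _ _ (t1 + c) _ mX1) (fun=> expR_ge0 _).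
  by rewrite ge0_integralZl// lee_fin powR_ge0.
have := gamma_laplace p10 (ltW l0) tc0 (probability_setT (distribution P X1)) HX1.
rewrite ge0_integral_pushforward//; last first.
  by apply/measurable_EFinP; exact: mE.
rewrite preimage_setT /comp => ->; rewrite -EFinM -powRM ?(ltW Sp)//; last first.
  by rewrite addr_ge0// mulr_ge0.
congr (_ `^ _)%:E.
rewrite /c !big_ord_recl big_ord0 /al /rho !(tnth_nth 0)/= /P3 -/t1 -/t2 -/t3.
rewrite /r2 /r3 /rS /al1 /al2 /al3 /al4 /al5 /b12 /b13 /b23 /b123 /oq2 /oq3 /oq23.
(* The side conditions are the cleared denominators of [r2], [r3] and [rS], all sums of nonnegative
   terms with a positive one. *)
rewrite /S; field; rewrite pn1 pn123 pn12 pn13/= !gt_eqF//.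
- by apply: ltr_wpDr; first rewrite mulr_ge0 ?ltW.
- by apply: ltr_wpDr; first rewrite mulr_ge0 ?ltW.
- by do 3 (apply: ltr_wpDr; first by rewrite !mulr_ge0 ?ltW).
Qed.
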